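(* Let $G$ be a connected graph. Then $G$ is IPP-extremal if and only if $G$ satisfies one of the following: (i) all blocks of $G$ are odd complete graphs; (ii) all blocks of $G$ except one are odd complete graphs, and the unique block of $G$ that is not an odd complete graph is even and IPP-extremal.
   Context: All graphs are finite, simple, and nonnull (at least one vertex). A graph $G$ is even (resp. odd) if $|V(G)|$ is even (resp. odd). A path in $G$ may consist of a single vertex. An isometric path in $G$ is a path in $G$ that is of smallest possible length (number of edges) among all paths in $G$ between its two endpoints (one-vertex paths are isometric). An isometric path partition (IPP) of $G$ is a collection of isometric paths in $G$ whose vertex sets partition $V(G)$; $\text{ipp}(G)$ is the smallest cardinality of an IPP of $G$. The matching number $\nu(G)$ is the largest cardinality of a matching of $G$. $G$ is IPP-extremal if $\text{ipp}(G) = |V(G)|-\nu(G)$. A cut-vertex of a graph $G$ on at least two vertices is a vertex $v$ such that $G \setminus v$ has more connected components than $G$. A graph is biconnected if it is connected and has no cut-vertices (so all complete graphs, including those on one and two vertices, are biconnected). A block of $G$ is a maximal biconnected induced subgraph of $G$. *)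

(* Defs.v *)
From mathcomp Require Import all_boot.

Set Implicit Arguments.
Unset Strict Implicit.
Unset Printing Implicit Defensive.

(* The null graph is not excluded here: nonnullity is part of [connected]. *)
Record sgraph := SGraph {
  vertex :> finType;
  adj : rel vertex;
  adj_sym : symmetric adj;
  adj_irr : irreflexive adj }.

Section Induced.
Variables (G : sgraph) (S : {set G}).

Definition induced_adj : rel {x : G | x \in S} :=
  fun x y => adj (val x) (val y).

Lemma induced_adj_sym : symmetric induced_adj.
Proof. by move=> x y; apply: adj_sym. Qed.

Lemma induced_adj_irr : irreflexive induced_adj.
Proof. by move=> x; apply: adj_irr. Qed.

Definition induced : sgraph := SGraph induced_adj_sym induced_adj_irr.

End Induced.

Definition is_path (G : sgraph) (p : seq G) : bool :=
  if p is x :: s then path (@adj G) x s && uniq p else false.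

(* A path of [G] is the sequence of its vertices. The repetition-free
   sequences have size at most #|G|, so bounding the size by #|G| loses no
   path and makes the type of paths finite. A path and its reversal are
   distinct elements of this type. *)
Definition gpath (G : sgraph) : finType := {p : #|G|.-bseq G | is_path p}.

Definition verts (G : sgraph) (p : gpath G) : seq G := val p.

Definition plength (G : sgraph) (p : gpath G) : nat := (size (verts p)).-1.

Definition same_ends (G : sgraph) (p q : gpath G) : bool :=
  (ohead (verts p) == ohead (verts q))
  && (ohead (rev (verts p)) == ohead (rev (verts q))).

Definition isometric (G : sgraph) (p : gpath G) : bool :=
  [forall q : gpath G, same_ends p q ==> (plength p <= plength q)].

(* The vertex sets of the members partition the vertices of [G]: paths are
   nonempty, so it is enough that each vertex lies on exactly one member. *)
Definition is_IPP (G : sgraph) (P : {set gpath G}) : bool :=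
  [forall p in P, isometric p]
  && [forall v : G, #|[set p in P | v \in verts p]| == 1].

Section IPPExists.
Variable G : sgraph.

Lemma size_seq1_le (v : G) : size [:: v] <= #|G|.
Proof. by apply/card_gt0P; exists v. Qed.

Definition path1 (v : G) : gpath G :=
  exist (fun p : #|G|.-bseq G => is_path p) (Bseq (size_seq1_le v)) isT.

Lemma IPP_exists : exists k, [exists P : {set gpath G}, is_IPP P && (#|P| == k)].
Proof.
exists #|[set path1 v | v : G]|; apply/existsP; exists [set path1 v | v : G].
rewrite eqxx andbT; apply/andP; split.
  apply/forall_inP=> p /imsetP[v _ ->]; apply/forallP=> q; exact/implyP.
apply/forallP=> v; apply/cards1P; exists (path1 v); apply/setP=> p.
rewrite !inE; apply/andP/eqP => [[/imsetP[w _ ->]]|->].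
  by rewrite inE => /eqP->.
by rewrite imset_f // inE.
Qed.

End IPPExists.

Definition ipp (G : sgraph) : nat := ex_minn (IPP_exists G).

Definition edges (G : sgraph) : {set {set G}} :=
  [set [set p.1; p.2] | p : G * G & adj p.1 p.2].

Definition matching (G : sgraph) (M : {set {set G}}) : bool :=
  (M \subset edges G) && trivIset M.

Definition matching_number (G : sgraph) : nat :=
  \max_(M : {set {set G}} | matching M) #|M|.

(* No truncation occurs in the subtraction: a matching with k edges covers
   2k vertices. *)
Definition IPP_extremal (G : sgraph) : bool :=
  ipp G == #|G| - matching_number G.

Definition connected (G : sgraph) : bool :=
  (0 < #|G|) && [forall x : G, forall y : G, connect (@adj G) x y].

Definition components (G : sgraph) : nat := n_comp (@adj G) G.

Definition cut_vertex (G : sgraph) (v : G) : bool :=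
  (1 < #|G|) && (components G < components (induced [set~ v])).

Definition biconnected (G : sgraph) : bool :=
  connected G && [forall v : G, ~~ cut_vertex v].

(* A block is given by its vertex set. *)
Definition block (G : sgraph) (B : {set G}) : bool :=
  maxset (fun S : {set G} => biconnected (induced S)) B.

Definition complete (G : sgraph) : bool :=
  [forall x : G, forall y : G, (x != y) ==> adj x y].

Definition odd_complete (G : sgraph) : bool := odd #|G| && complete G.

(* Main.v *)
Require Import Defs.
From mathcomp Require Import all_boot zify.

(** Write [n - nu] for the number of paths obtained from a maximum matching:
its edges, and the uncovered vertices as one-vertex paths. Such a family is an
IPP, so [ipp G <= n - nu], and [G] is IPP-extremal when no IPP beats a maximum
matching. All arguments take place inside one ambient graph [G], for the
subgraphs [G[A]] induced by vertex sets [A]; [extremal A] says that [G[A]] is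
IPP-extremal.

The basic improvement is the following. If a maximum matching misses [x], has
an edge [ab] with [x] adjacent to [a], and [x] is not adjacent to [b], then the
isometric path [x a b] saves one path. So in an extremal graph [x] is adjacent
to [b] as well, and the edge [xb] can replace [ab]: the missed vertex moves
from [x] to its neighbour [a]. If the matching missed a second vertex, the
missed vertex could travel to a neighbour of it along a path, and the matching
could be enlarged. Hence a connected extremal graph has a perfect matching, or
one that misses a single vertex ([tight_near_perfect]).

The heart of the proof, [rooted_leaf], concerns a connected set [H] with a root
[v] such that [H - v] has a perfect matching and no partition of [H] into
geodesics in which [v] is an endpoint uses fewer paths than this matching
together with [v]. Take a maximal odd clique [K] that contains [v] and whose
complement in [H] has a perfect matching. The improvement above, applied while
the missed vertex travels through [H - K], shows that every component [Q] of
[H - K] is attached to a single vertex [x] of [K] ([core_attach]): a second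
attachment would yield a vertex adjacent to all of [K], and with its partner
[K] would grow. The set [Q + x] with root [x] inherits the hypotheses
([core_branch_tight]), because a geodesic of [Q + x] that ends at [x] can be
continued through the cut-vertex [x] into [K]. By induction [H] has a leaf: an
odd clique with at least three vertices, attached to the rest by one vertex.

If an extremal set is connected with a cut-vertex, this produces a leaf: apply
[rooted_leaf] to the whole set if a matching misses one vertex, and otherwise
to a cut-vertex together with a component that does not contain its partner
([extremal_leaf]). Conversely, (i) or (ii) produces a leaf because a smallest
branch at a cut-vertex that avoids the exceptional block is itself a block
([block_condition_has_leaf]).

Finally, a leaf can be peeled. Let [U] be a leaf without its attaching vertex;
[U] is a clique with an even number of vertices. Removing [U] preserves and
reflects extremality ([extremal_peel]), because geodesics meet cliques in at
most two vertices, and it removes exactly one block ([block_in_leaf]).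
Induction on the number of vertices ends with a biconnected set, which
[rooted_leaf] shows to be an odd clique or even. *)

Set Implicit Arguments.
Unset Strict Implicit.
Unset Printing Implicit Defensive.

(* Only the sizes of sets matter here: each cardinal becomes a variable. *)
Ltac card_lia :=
  repeat match goal with |- context [@card ?T ?m] => generalize (@card T m) end;
  clear; lia.

(** * Geodesics of induced subgraphs *)

Section Geodesics.
Variable G : sgraph.
Implicit Types (x y z v w : G) (s t p q : seq G) (A B C X Y : {set G}).

Definition walk A x s : bool := path (@adj G) x s && all (mem A) (x :: s).

(** Minimality is required among walks: a shortest walk never repeats a vertex,
so these are the isometric paths of [G[A]]. *)
Definition geodesic A p : Prop :=
  if p is x :: s then
    walk A x s /\ forall t, walk A x t -> last x t = last x s -> size s <= size t
  else False.

Lemma walk_cons A x y s : walk A x (y :: s) = [&& x \in A, adj x y & walk A y s].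
Proof. by rewrite /walk /=; case: (x \in A); case: (adj x y); rewrite ?andbF. Qed.

Lemma walk_nil A x : walk A x [::] = (x \in A).
Proof. by rewrite /walk /= andbT. Qed.

Lemma walk_head A x s : walk A x s -> x \in A.
Proof. by case/andP=> _ /andP[]. Qed.

Lemma walk_cat A x s t : walk A x (s ++ t) = walk A x s && walk A (last x s) t.
Proof.
elim: s x => [|y s IH] x /=; last by rewrite !walk_cons IH !andbA.
rewrite walk_nil; case: (boolP (x \in A)) => //= xA.
by apply/negP => /walk_head; rewrite (negPf xA).
Qed.

Lemma walk_sub A B x s :
  {subset x :: s <= B} -> walk A x s -> walk B x s.
Proof. by move=> sB /andP[xs _]; rewrite /walk xs; apply/allP. Qed.

Lemma walk_mem A x s y : walk A x s -> y \in x :: s -> y \in A.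
Proof. by case/andP=> _ /allP/(_ y). Qed.

Lemma geo_mem A p y : geodesic A p -> y \in p -> y \in A.
Proof. by case: p => // x s [/walk_mem sA _]; apply: sA. Qed.

Lemma geo_cat A x s y t :
  geodesic A (x :: s ++ y :: t) -> geodesic A (x :: s) /\ geodesic A (y :: t).
Proof.
case; rewrite walk_cat walk_cons => /and4P[xs lA sy yt] min_st.
split; split=> // u Wu lu.
  have /min_st : walk A x (u ++ y :: t).
    by rewrite walk_cat Wu lu walk_cons lA sy yt.
  by rewrite !last_cat /= !size_cat leq_add2r; apply.
have /min_st : walk A x (s ++ y :: u).
  by rewrite walk_cat xs walk_cons lA sy Wu.
by rewrite !last_cat /= !size_cat leq_add2l ltnS; apply.
Qed.

Lemma geo_uniq A p : geodesic A p -> uniq p.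
Proof.
elim: p => // x s IH gxs; case: s => [|y s] in IH gxs *; first by [].
have [_ /IH /= ->] := geo_cat (s := [::]) gxs; rewrite andbT.
apply/negP => /splitPr; case: gxs => Ws min_s D.
case: D Ws min_s => s1 s2; rewrite walk_cat walk_cons => /and4P[_ _ _ W2].
by move=> /(_ _ W2); rewrite last_cat /= size_cat /= => /(_ erefl); lia.
Qed.

Lemma geo_sub A B p : B \subset A -> {subset p <= B} -> geodesic A p -> geodesic B p.
Proof.
case: p => // x s /subsetP BA sB [Ws min_s]; split; first exact: walk_sub Ws.
by move=> t Wt; apply: min_s; apply: (walk_sub _ Wt) => z /(walk_mem Wt)/BA.
Qed.

Lemma geo1 A x : x \in A -> geodesic A [:: x].
Proof. by move=> xA; split; rewrite ?walk_nil. Qed.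

Lemma adj_neq x y : adj x y -> x != y.
Proof. by apply: contraTneq => ->; rewrite adj_irr. Qed.

Lemma geo2 A x y : x \in A -> y \in A -> adj x y -> geodesic A [:: x; y].
Proof.
move=> xA yA xy; split; first by rewrite !walk_cons walk_nil xA xy.
by case=> //= _ exy; rewrite exy adj_irr in xy.
Qed.

Lemma geo3 A x y z : x \in A -> y \in A -> z \in A ->
  adj x y -> adj y z -> ~~ adj x z -> x != z -> geodesic A [:: x; y; z].
Proof.
move=> xA yA zA xy yz nxz xz; split; first by rewrite !walk_cons walk_nil xA xy yA yz.
case=> [|u [|//]] /=; first by move=> _ exz; rewrite exz eqxx in xz.
by rewrite walk_cons => /and3P[_ xu _] euz; rewrite -euz xu in nxz.
Qed.

End Geodesics.

(** * Perfect matchings and partitions into geodesics *)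

Section Covers.
Variable G : sgraph.
Implicit Types (x y z v w a b : G) (s t p q : seq G) (A B C X Y : {set G}).

(** [G[X]] has a perfect matching, built by adding one edge at a time.
The removal form lets the matching edge at a given vertex be split off
([matchable_partner]), and no matching has to be named. *)
Inductive matchable : {set G} -> Prop :=
| matchable0 : matchable set0
| matchableS a b X : a \in X -> b \in X -> adj a b ->
    matchable (X :\: [set a; b]) -> matchable X.

(** The geodesics are those of a fixed [G[A]], while the set [X] that remains to
be partitioned shrinks. *)
Inductive geo_partition A : {set G} -> nat -> Prop :=
| geo_partition0 : geo_partition A set0 0
| geo_partitionS p X k : geodesic A p -> {subset p <= X} ->
    geo_partition A (X :\: [set z in p]) k -> geo_partition A X k.+1.

Definition clique X : Prop := {in X &, forall x y, x != y -> adj x y}.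

Lemma card_setD2 X a b : a \in X -> b \in X -> a != b ->
  #|X| = #|X :\: [set a; b]|.+2.
Proof.
move=> aX bX ab; rewrite -(cardsID [set a; b] X) (setIidPr _) ?cards2 ?ab //.
by apply/subsetP=> z /set2P[]->.
Qed.

Lemma matchable_partner X a : matchable X -> a \in X ->
  exists b, [/\ b \in X, adj a b & matchable (X :\: [set a; b])].
Proof.
elim=> [|c d {}X cX dX cd pmX IH aX]; first by rewrite inE.
have [->|ac] := eqVneq a c; first by exists d.
have [->|ad] := eqVneq a d; first by exists c; rewrite adj_sym setUC.
have /IH[b [bX ab pmb]] : a \in X :\: [set c; d] by rewrite !inE negb_or ac ad.
move: bX; rewrite !inE => /andP[/norP[bc bd] bX]; exists b; split=> //.
apply: (@matchableS c d) => //; first by rewrite !inE cX !(eq_sym c) negb_or ac bc.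
  by rewrite !inE dX !(eq_sym d) negb_or ad bd.
by rewrite setDDl setUC -setDDl.
Qed.

Lemma matchableU X Y : matchable X -> matchable Y -> [disjoint X & Y] ->
  matchable (X :|: Y).
Proof.
move=> pmX pmY; elim: pmX => [|a b {}X aX bX ab _ IH] dXY; first by rewrite set0U.
have aY : a \notin Y by rewrite (disjointFr dXY).
have bY : b \notin Y by rewrite (disjointFr dXY).
apply: (matchableS _ _ ab); rewrite ?inE ?aX ?bX //.
rewrite setDUl [Y :\: _](setDidPl _); last first.
  by rewrite disjoint_sym disjoints_subset; apply/subsetP=> z /set2P[]->; rewrite inE.
by apply: IH; apply: disjointWl dXY; apply: subsetDl.
Qed.

Lemma matchable_even X : matchable X -> ~~ odd #|X|.
Proof.
elim=> [|a b {}X aX bX /adj_neq ab _ IH]; first by rewrite cards0.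
by rewrite (card_setD2 aX bX ab) /= negbK.
Qed.

(** The edges of a perfect matching cannot leave a union of components. *)
Lemma matchable_restrict X C : matchable X -> C \subset X ->
  {in C & X, forall x y, adj x y -> y \in C} -> matchable C.
Proof.
move=> pmX; elim: pmX C => [|a b {}X aX bX ab _ IH] C sCX clC.
  by move: sCX; rewrite subset0 => /eqP->; apply: matchable0.
have abC : (a \in C) = (b \in C).
  by apply/idP/idP => hC; [apply: (clC a) | apply: (clC b); rewrite // adj_sym].
case aC: (a \in C).
  apply: (matchableS aC _ ab); first by rewrite -abC.
  apply: IH => [|x y]; first exact: setSD.
  rewrite !inE => /andP[_ xC] /andP[-> yX] xy; exact: clC xC yX xy.
apply: IH => [|x y xC /setDP[yX _]]; last exact: clC.
rewrite subsetD sCX disjoint_sym disjoints_subset.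
by apply/subsetP=> z /set2P[]->; rewrite inE -?abC aC.
Qed.

Lemma clique_sub X Y : Y \subset X -> clique X -> clique Y.
Proof. by move/subsetP=> sYX clX x y /sYX xX /sYX yX; apply: clX. Qed.

Lemma even_clique_matchable X : clique X -> ~~ odd #|X| -> matchable X.
Proof.
have [n] := ubnP #|X|; elim: n X => // n IH X leX clX evX.
have [->|[a aX]] := set_0Vmem X; first exact: matchable0.
have [X1|[b /setD1P[ba bX]]] := set_0Vmem (X :\ a).
  by rewrite (cardsD1 a) aX X1 cards0 in evX.
have ab : a != b by rewrite eq_sym.
apply: (matchableS aX bX (clX _ _ aX bX ab)).
move: evX leX; rewrite (card_setD2 aX bX ab) /= negbK => evX leX.
apply: IH => //; first lia.
exact: clique_sub (subsetDl _ _) clX.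
Qed.

Lemma geo_partitionU A X Y k l :
    geo_partition A X k -> geo_partition A Y l -> [disjoint X & Y] ->
  geo_partition A (X :|: Y) (k + l).
Proof.
move=> covX covY; elim: covX => [|p {}X {}k gp sp _ IH] dXY; first by rewrite set0U.
rewrite addSn; apply: (geo_partitionS gp) => [z /sp zX|]; first by rewrite inE zX.
rewrite setDUl [Y :\: _](setDidPl _); last first.
  rewrite disjoint_sym disjoints_subset; apply/subsetP=> z; rewrite !inE => /sp zX.
  by rewrite (disjointFr dXY).
by apply: IH; apply: disjointWl dXY; apply: subsetDl.
Qed.

Lemma geo_partition_mono A B X k : (forall p, geodesic A p -> geodesic B p) ->
  geo_partition A X k -> geo_partition B X k.
Proof.
move=> AB; elim=> [|p {}X {}k gp pX _]; first exact: geo_partition0.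
by apply: geo_partitionS pX; apply: AB.
Qed.

Lemma geo_partition_singletons A X : X \subset A -> geo_partition A X #|X|.
Proof.
have [n] := ubnP #|X|; elim: n X => // n IH X leX sXA.
have [->|[a aX]] := set_0Vmem X; first by rewrite cards0; apply: geo_partition0.
rewrite (cardsD1 a) aX add1n; apply: (geo_partitionS (p := [:: a])).
- by apply: geo1; apply: (subsetP sXA).
- by move=> z; rewrite inE => /eqP->.
have -> : [set z in [:: a]] = [set a] by apply/setP=> z; rewrite !inE.
apply: IH; last exact: subset_trans (subsetDl _ _) sXA.
by rewrite (cardsD1 a) aX in leX; lia.
Qed.

Lemma matchable_partition A X : matchable X -> X \subset A -> geo_partition A X #|X|./2.
Proof.
elim=> [|a b {}X aX bX ab _ IH] /subsetP sXA; first by rewrite cards0; apply: geo_partition0.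
rewrite (card_setD2 aX bX (adj_neq ab)) /=; apply: (geo_partitionS (p := [:: a; b])).
- by apply: geo2; rewrite ?sXA.
- by move=> z; rewrite !inE => /orP[]/eqP->.
have -> : [set z in [:: a; b]] = [set a; b] by apply/setP=> z; rewrite !inE.
by apply: IH; apply/subsetP=> z /setDP[/sXA].
Qed.

End Covers.

(** * Connectivity and cut-vertices *)

Section Connectivity.
Variable G : sgraph.
Implicit Types (x y z v w a b : G) (s t p q : seq G) (A B C X Y S : {set G}).

Definition radj A : rel G := [rel x y | [&& x \in A, y \in A & adj x y]].

Definition connected_in A : bool :=
  (A != set0) && [forall x in A, forall y in A, connect (radj A) x y].

(** The one-vertex sets need the case [A :\ v == set0]: the empty set is not
connected here. *)
Definition biconnected_in A : bool :=
  connected_in A && [forall v in A, (A :\ v == set0) || connected_in (A :\ v)].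

Lemma connected_inP A :
  reflect (A != set0 /\ {in A &, forall x y, connect (radj A) x y}) (connected_in A).
Proof.
apply: (iffP andP) => -[nA cA]; split=> //.
  by move=> x y xA yA; move/forall_inP/(_ _ xA)/forall_inP: cA; apply.
by apply/forall_inP=> x xA; apply/forall_inP=> y yA; apply: cA.
Qed.

(** Connectivity is used through this induction principle: a property that
passes along edges inside [A] passes along connections inside [A]. *)
Lemma connect_radj_ind A (P : G -> Prop) x y :
    connect (radj A) x y ->
    (forall a b, a \in A -> b \in A -> adj a b -> P a -> P b) ->
  P x -> P y.
Proof.
move=> /connectP[s xs ->] stepP; elim: s x xs => //= z s IH x.
by case/andP=> /and3P[xA zA xz] zs /(stepP _ _ xA zA xz); apply: IH.
Qed.

Lemma radj_sym A : symmetric (radj A).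
Proof. by move=> x y; rewrite /radj /= andbCA [adj y x]adj_sym. Qed.

Lemma connect_radj_sym A : connect_sym (radj A).
Proof. exact/sym_connect_sym/radj_sym. Qed.

Lemma conn_closed A S x : connected_in A -> x \in A -> x \in S ->
  (forall a b, a \in A -> b \in A -> adj a b -> a \in S -> b \in S) ->
  A \subset S.
Proof.
move=> /connected_inP[_ cA] xA xS clS; apply/subsetP=> y yA.
exact: (connect_radj_ind (P := fun z => z \in S) (cA x y xA yA)).
Qed.

Definition component A x : {set G} := [set y | connect (radj A) x y].

Lemma component_refl A x : x \in component A x.
Proof. by rewrite inE connect0. Qed.

Lemma component_sub A x : x \in A -> component A x \subset A.
Proof.
move=> xA; apply/subsetP=> y; rewrite inE => xy.
exact: (connect_radj_ind (P := fun z => z \in A) xy).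
Qed.

Lemma component_closed A x : x \in A ->
  {in component A x & A, forall y z, adj y z -> z \in component A x}.
Proof.
move=> xA y z yC zA yz; have yA := subsetP (component_sub xA) y yC.
move: yC; rewrite !inE => /connect_trans; apply; apply: connect1.
by rewrite /radj /= yA zA.
Qed.

Lemma conn_component A x : x \in A -> connected_in (component A x).
Proof.
move=> xA; have xC := component_refl A x.
have cx z : z \in component A x -> connect (radj (component A x)) x z.
  rewrite inE => xz.
  pose P y := y \in component A x /\ connect (radj (component A x)) x y.
  suff [] : P z by [].
  apply: (connect_radj_ind xz); last by split; rewrite ?connect0.
  move=> a b aA bA ab [aC xa]; have bC := component_closed xA aC bA ab.
  split=> //; apply: connect_trans xa _; apply: connect1.
  by rewrite /radj /= aC bC.
apply/connected_inP; split=> [|y z yC zC]; first by apply/set0Pn; exists x.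
by apply: connect_trans (cx z zC); rewrite connect_radj_sym; apply: cx.
Qed.

(** [C] is a union of components of [A - w]; the sets [A :\: C] and [w |: C]
are then glued at the single vertex [w]. *)
Record pendant A w C : Prop := Pendant {
  pendant_root : w \in A;
  pendant_sub : C \subset A :\ w;
  pendant_adj : {in C & A, forall x y, adj x y -> y \in w |: C} }.

Lemma pendant_notin A w C : pendant A w C -> w \notin C.
Proof. by case=> _ sC _; apply/negP => /(subsetP sC); rewrite !inE eqxx. Qed.

Lemma pendant_branch_sub A w C : pendant A w C -> w |: C \subset A.
Proof. by case=> wA sC _; rewrite subUset sub1set wA (subset_trans sC) ?subsetDl. Qed.

(** The two sides of a gluing play symmetric roles. *)
Lemma pendantC A w C : pendant A w C -> pendant A w (A :\: (w |: C)).
Proof.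
move=> pC; have [wA sC adjC] := pC; split=> //.
  apply/subsetP=> x; rewrite !inE negb_or => /andP[/andP[-> _] ->].
  by [].
move=> x y; rewrite !inE negb_or => /andP[/andP[xw xC] xA] yA xy.
rewrite yA andbT; case: (eqVneq y w) => //= yw.
apply/negP => yC; have := adjC _ _ yC xA; rewrite adj_sym !inE => /(_ xy).
by rewrite (negPf xw) (negPf xC).
Qed.

Lemma pendant_complK A w C : pendant A w C -> A :\: (A :\: (w |: C)) = w |: C.
Proof. by move/pendant_branch_sub=> /setIidPr; rewrite setDDr setDv set0U. Qed.

Lemma pendant_component A w x : w \in A -> x \in A :\ w ->
  pendant A w (component (A :\ w) x).
Proof.
move=> wA xA; split=> //; first exact: component_sub.
move=> y z yC zA yz; rewrite in_setU1; case: eqVneq => //= zw.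
by apply: component_closed yC _ yz; rewrite // !inE zw.
Qed.

Lemma pendant_trans A w C u D : pendant A w C -> pendant (w |: C) u D ->
  w \notin D -> pendant A u D.
Proof.
move=> pC pD wD; have sA := subsetP (pendant_branch_sub pC).
have sD := subsetP (pendant_sub pD).
split; first exact/sA/(pendant_root pD).
  by apply/subsetP=> z /sD; rewrite !in_setD1 => /andP[-> /sA].
move=> y z yD zA yz; apply: (pendant_adj pD yD _ yz).
apply: (pendant_adj pC _ zA yz).
have /setD1P[_] := sD y yD; rewrite in_setU1 => /predU1P[yw|//].
by rewrite yw (negPf wD) in yD.
Qed.

(** A retraction of [G[A]] onto [A :\: C]: an edge is mapped to an edge or
collapsed. *)
Definition retract w C x := if x \in C then w else x.

Lemma retract_in A w C x : pendant A w C -> x \in A -> retract w C x \in A :\: C.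
Proof.
move=> pC xA; rewrite /retract inE; case: ifP => [_|->]; last by [].
by rewrite (pendant_notin pC) (pendant_root pC).
Qed.

Lemma retract_adj A w C x y : pendant A w C -> x \in A -> y \in A -> adj x y ->
  retract w C x = retract w C y \/ adj (retract w C x) (retract w C y).
Proof.
move=> pC; have [_ _ adjC] := pC; move=> xA yA xy; rewrite /retract.
case: ifP => xC; case: ifP => yC; try by [left | right].
  by have := adjC _ _ xC yA xy; rewrite !inE yC orbF => /eqP; left.
rewrite adj_sym in xy; have := adjC _ _ yC xA xy.
by rewrite !inE xC orbF => /eqP; left.
Qed.

(** A walk that enters the pendant set must come back through the root, so
collapsing the excursion leaves a walk that is no longer than before. *)
Lemma walk_retract A w C x s : pendant A w C -> walk A x s ->
  exists t, [/\ walk (A :\: C) (retract w C x) t,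
                last (retract w C x) t = retract w C (last x s) & size t <= size s].
Proof.
move=> pC; elim: s x => [|y s IH] x.
  by rewrite walk_nil => xA; exists [::]; rewrite walk_nil retract_in.
rewrite walk_cons => /and3P[xA xy /[dup] ys /IH[t [Wt lt st]]].
have [|rxy] := retract_adj pC xA (walk_head ys) xy.
  by move=> ->; exists t; split=> //=; apply: leqW.
by exists (retract w C y :: t); rewrite walk_cons rxy Wt (retract_in pC xA).
Qed.

(** A shorter walk in [A] would retract to a shorter walk in [A :\: C]. *)
Lemma geo_trunk A w C p : pendant A w C -> geodesic (A :\: C) p -> geodesic A p.
Proof.
move=> pC; case: p => // x s [Ws min_s]; split.
  by apply: (walk_sub _ Ws) => z /(walk_mem Ws)/setDP[].
move=> t Wt lt; have [u [Wu lu su]] := walk_retract pC Wt.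
have [_ xC] := setDP (walk_head Ws).
have [_ lC] : _ /\ last x s \notin C := setDP (walk_mem Ws (mem_last x s)).
rewrite lt /retract (negPf xC) (negPf lC) in Wu lu.
exact: leq_trans (min_s _ Wu lu) su.
Qed.

Lemma geo_branch A w C p : pendant A w C -> geodesic (w |: C) p -> geodesic A p.
Proof.
by move=> pC; rewrite -(pendant_complK pC); apply: geo_trunk; apply: pendantC.
Qed.

(** Every walk from [y] to the end of [s] has to enter [w |: C] at [w], and it
needs at least one step for that. *)
Lemma geo_extend A w C s y : pendant A w C -> geodesic (w |: C) (w :: s) ->
  y \in A -> y \notin w |: C -> adj w y -> geodesic A [:: y, w & s].
Proof.
move=> pC [Ws min_s] yA yC wy; have wA := pendant_root pC.
have sCA := subsetP (pendant_branch_sub pC).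
have lC : last w s \in w |: C by apply: walk_mem Ws (mem_last _ _).
split.
  rewrite walk_cons yA adj_sym wy /=; apply: (walk_sub _ Ws) => z.
  by move/(walk_mem Ws)/sCA.
case=> [_ /= ly|u t]; first by rewrite -ly (negPf yC) in lC.
rewrite walk_cons /= => /and3P[_ yu Wt] lt; rewrite ltnS.
have uA := walk_head Wt.
have [r [Wr lr sr]] := walk_retract (pendantC pC) Wt.
rewrite (pendant_complK pC) lt in Wr lr.
have ru : retract w (A :\: (w |: C)) u = w.
  rewrite /retract !inE uA andbT; case: (eqVneq u w) => //= uw.
  case: ifP => // /negbFE uC; rewrite adj_sym in yu.
  by have := pendant_adj pC uC yA yu; rewrite (negPf yC).
rewrite ru /retract in_setD lC /= in lr; rewrite ru in Wr.
exact: leq_trans (min_s _ Wr lr) sr.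
Qed.

Lemma conn_trunk A w C : pendant A w C -> connected_in A -> connected_in (A :\: C).
Proof.
move=> pC /connected_inP[_ cA]; have [wA _ _] := pC.
apply/connected_inP; split=> [|x y /setDP[xA xC] /setDP[yA yC]].
  by apply/set0Pn; exists w; rewrite inE wA (pendant_notin pC).
have <- : retract w C y = y by rewrite /retract (negPf yC).
apply: (connect_radj_ind (P := fun z => connect _ x (retract w C z)) (cA x y xA yA)).
  move=> a b aA bA ab xa; have [<- //|rab] := retract_adj pC aA bA ab.
  apply: connect_trans xa (connect1 _).
  by rewrite /radj /= rab !(retract_in pC).
by rewrite /retract (negPf xC).
Qed.

Lemma conn_branch A w C : pendant A w C -> connected_in A -> connected_in (w |: C).
Proof. by move=> pC; rewrite -(pendant_complK pC); apply/conn_trunk/pendantC. Qed.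

(** If [S] met both sides outside [w], removing [w] would disconnect [S]. *)
Lemma biconn_side A w C S : pendant A w C -> S \subset A -> biconnected_in S ->
  (S \subset A :\: C) || (S \subset w |: C).
Proof.
move=> pC sSA /andP[cS /forall_inP bS]; rewrite subsetD sSA /=.
case: (boolP [disjoint S & C]) => // /pred0Pn[c /andP[/= cS' cC]].
apply/negPn/negP => /subsetPn[d dS dC].
have cw : c != w by apply: contraTneq cC => ->; apply: pendant_notin pC.
have cSw : connected_in (S :\ w).
  case: (boolP (w \in S)) => [/bS/orP[/eqP Sw|//]|wS].
    by have := in_set0 c; rewrite -Sw !inE cw cS'.
  suff -> : S :\ w = S by [].
  by apply/setP=> z; rewrite !inE; case: eqVneq => // ->; rewrite (negPf wS).
have /subsetP/(_ d) : S :\ w \subset C.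
  apply: (conn_closed (x := c) cSw) => // [|a b]; rewrite !inE ?cw //.
  move=> /andP[_ aS] /andP[bw bS'] ab aC.
  have := pendant_adj pC aC (subsetP sSA b bS') ab.
  by rewrite !inE (negPf bw).
by move: dC; rewrite !inE dS andbT => /norP[-> /negPf->] /(_ isT).
Qed.

End Connectivity.

(** * Geodesics that meet a leaf *)

Section Peeling.
Variable G : sgraph.
Implicit Types (x y z v w a b : G) (s t p q : seq G) (A B C X Y S : {set G}).

Lemma geo_prefix A p q : p != [::] -> geodesic A (p ++ q) -> geodesic A p.
Proof. by case: p => // x s _; case: q => [|y t]; [rewrite cats0 | case/geo_cat]. Qed.

Lemma geo_suffix A p q : q != [::] -> geodesic A (p ++ q) -> geodesic A q.
Proof. by case: q => // y t _; case: p => [|x s] // /geo_cat[]. Qed.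

(** Three vertices of a clique on a path can be short-cut by the edge between
the first and the last of them. *)
Lemma geo_clique A B p : clique B -> geodesic A p -> #|[set x in p] :&: B| <= 2.
Proof.
move=> clB; elim: p => // x s IH gp; have := geo_uniq gp.
case: s => [|y s] in IH gp *.
  move=> _; apply: leq_trans (subset_leq_card (subsetIl _ _)) _.
  by rewrite cardsE (leq_trans (card_size _)).
case: (boolP (x \in B)) => xB /=; last first.
  have /IH leB : geodesic A (y :: s) by apply: (@geo_suffix A [:: x] _ _ gp).
  move=> _; apply: leq_trans leB.
  apply/subset_leq_card/subsetP=> z; rewrite !inE => /andP[/orP[/eqP->|->->//]].
  by rewrite (negPf xB).
rewrite inE negb_or => /andP[/andP[xy xs] _].
suff /subset_leq_card sxy : [set z in [:: x, y & s]] :&: B \subset [set x; y].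
  by apply: leq_trans sxy _; rewrite cards2 xy.
apply/subsetP=> z; rewrite !inE orbA => /andP[/orP[//|zs] zB].
case/splitPr: zs gp xs => s1 s2 [W min_s] xs.
have xz : x != z by apply: contraNneq xs => ->; rewrite mem_cat inE eqxx orbT.
have Wz : walk A x (z :: s2).
  rewrite walk_cons (walk_head W) (clB _ _ xB zB xz).
  by move: W; rewrite -cat_cons walk_cat => /andP[_]; rewrite walk_cons => /and3P[].
by have := min_s _ Wz; rewrite /= last_cat /= size_cat /= => /(_ erefl); lia.
Qed.

(** An odd clique on at least three vertices that is attached to the rest of
[A] at most at [w]. *)
Record leaf A B w : Prop := Leaf {
  leaf_root : w \in B;
  leaf_pendant : pendant A w (B :\ w);
  leaf_clique : clique B;
  leaf_odd : odd #|B|;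
  leaf_gt1 : 1 < #|B| }.

(** A walk that avoids the root stays on its side. *)
Lemma walk_side A w C y s : pendant A w C -> walk A y s -> w \notin y :: s ->
  {in s, forall z, (z \in C) = (y \in C)}.
Proof.
move=> pC; elim: s y => // z s IH y; rewrite walk_cons => /and3P[yA yz zs].
rewrite inE negb_or => /andP[wy wzs].
have zy : (z \in C) = (y \in C).
  have zA := walk_head zs.
  move: wzs; rewrite inE negb_or => /andP[wz _].
  apply/idP/idP=> [zC|yC].
    have := pendant_adj pC zC yA; rewrite adj_sym inE => /(_ yz).
    by rewrite inE eq_sym (negPf wy).
  by have := pendant_adj pC yC zA yz; rewrite !inE eq_sym (negPf wz).
by move=> u; rewrite inE => /predU1P[->//|us]; rewrite (IH _ zs wzs).
Qed.

(** What is left of a geodesic when the vertices [U] of a leaf are deleted: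
either nothing, or a geodesic, since a geodesic can only enter [U] at one of
its ends. In the second case it meets [U] at all only if it passes through [w],
and then in one vertex, as [w] is another vertex of the same clique. *)
Lemma geo_minus_leaf A B w p (U := B :\ w) : leaf A B w -> geodesic A p ->
  {subset p <= U} /\ size p <= 2 \/
  exists p', [/\ geodesic (A :\: U) p', [set x in p'] = [set x in p] :\: U
              & #|[set x in p] :&: U| <= (w \in p)].
Proof.
move=> [wB pU clB _ _] gp; have ug := geo_uniq gp.
have gB := geo_clique clB gp.
have [wp|wp] := boolP (w \in p); last first.
  case: p => // x s in gp ug wp gB *.
  have sd := walk_side pU (proj1 gp) wp.
  case: (boolP (x \in U)) => xU; [left | right].
    have sU : {subset x :: s <= U}.
      by move=> z; rewrite inE => /predU1P[->//|/sd->].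
    split=> //; apply: leq_trans gB; rewrite (setIidPl _); last first.
      by apply/subsetP=> z; rewrite inE => /sU/setD1P[].
    by rewrite cardsE (card_uniqP ug).
  have sU z : z \in x :: s -> z \notin U.
    by rewrite inE => /predU1P[->//|/sd->].
  exists (x :: s); split.
  - apply: (geo_sub _ _ gp); first exact: subsetDl.
    by move=> z zs; rewrite inE sU // (geo_mem gp).
  - apply/setP=> z; rewrite in_setD [LHS]in_set [X in _ && X]in_set.
    by apply/idP/andP=> [zs|[_ zs]] //; rewrite sU.
  rewrite leqn0 cards_eq0; apply/eqP/setP=> z.
  rewrite in_setI [RHS]in_set0 [X in X && _]in_set.
  by apply/negP => /andP[/sU/negPf->].
right.
have cU : #|[set x in p] :&: U| <= 1.
  rewrite -ltnS; apply: leq_trans gB.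
  rewrite [in X in _ <= X](cardsD1 w) !inE wp wB.
  rewrite ltnS; apply/subset_leq_card/subsetP=> z.
  by rewrite !inE => /andP[-> /andP[-> ->]].
case/splitPr: wp gp ug cU {gB} => p1 p2 gp ug cU.
have pA := geo_mem gp.
have w1 : w \notin p1 by move: ug; rewrite cat_uniq /= negb_or => /and3P[_ /andP[]].
have w2 : w \notin p2 by move: ug; rewrite cat_uniq /= => /and4P[].
have wU : w \notin U by rewrite !inE eqxx.
(* A stretch of the path between passages of [w] stays on one side. *)
have side q q1 q2 : p1 ++ w :: p2 = q1 ++ q ++ q2 -> w \notin q ->
    {in q, forall z, z \in U} \/ {in q, forall z, z \notin U}.
  case: q => [|x s] e wq; first by left.
  have gq : geodesic A (x :: s).
    by apply: (geo_prefix (q := q2)) => //; apply: (geo_suffix (p := q1)); rewrite -?e.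
  have sd := walk_side pU (proj1 gq) wq.
  case: (boolP (x \in U)) => xU; [left | right] => z;
    by rewrite inE => /predU1P[->//|/sd->].
have peel q : geodesic A q -> {subset q <= p1 ++ w :: p2} -> {in q, forall z, z \notin U} ->
    (forall z, z \in p1 ++ w :: p2 -> z \notin U -> z \in q) ->
    exists p', [/\ geodesic (A :\: U) p', [set x in p'] = [set x in p1 ++ w :: p2] :\: U
              & #|[set x in p1 ++ w :: p2] :&: U| <= true].
  move=> gq sq qU Uq; exists q; split=> //.
    apply: (geo_sub _ _ gq); first exact: subsetDl.
    by move=> z zq; rewrite inE qU // pA // sq.
  apply/setP=> z; rewrite in_setD [LHS]in_set [X in _ && X]in_set.
  by apply/idP/andP=> [zq|[zU zp]]; [rewrite qU ?sq | apply: Uq].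
have e2 : p1 ++ w :: p2 = (p1 ++ [:: w]) ++ p2 ++ [::] by rewrite cats0 -catA.
have side2 := side p2 _ _ e2 w2.
have inP z : (z \in p1 ++ w :: p2) = [|| z \in p1, z == w | z \in p2].
  by rewrite mem_cat in_cons.
have [U1|U1] := side p1 [::] (w :: p2) erefl w1; case: side2 => U2.
- apply: (peel [:: w]).
  + by apply: geo1; apply: pA; rewrite inP eqxx orbT.
  + by move=> z; rewrite mem_seq1 inP => ->; rewrite orbT.
  + by move=> z; rewrite mem_seq1 => /eqP->.
  by move=> z; rewrite mem_seq1 inP => /or3P[/U1->|->|/U2->].
- apply: (peel (w :: p2)).
  + by apply: (geo_suffix (p := p1)).
  + by move=> z; rewrite inP in_cons => ->; rewrite orbT.
  + by move=> z; rewrite in_cons => /predU1P[->|/U2].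
  by move=> z; rewrite inP in_cons => /orP[/U1->|->].
- apply: (peel (p1 ++ [:: w])).
  + by apply: (geo_prefix (q := p2)); [case: (p1) | rewrite -catA].
  + by move=> z; rewrite mem_cat mem_seq1 inP orbA => ->.
  + by move=> z; rewrite mem_cat mem_seq1 => /orP[/U1|/eqP->].
  by move=> z; rewrite inP mem_cat mem_seq1 orbA => /orP[->|/U2->].
apply: (peel (p1 ++ w :: p2)) => // z.
by rewrite inP => /or3P[/U1|/eqP->|/U2].
Qed.

End Peeling.

(** * Extremality and the removal of a leaf *)

Section Extremal.
Variable G : sgraph.
Implicit Types (x y z v w a b : G) (s t p q : seq G) (A B C X Y S : {set G}).

(** IPP-extremality of [G[A]]. The inequality [ipp <= n - nu] always holds, so
extremality only asks for one matching, covering some set [X], that bounds the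
size of every partition into geodesics from below; [X] then has maximum size. *)
Definition extremal A : Prop :=
  exists X, [/\ X \subset A, matchable X &
                forall k, geo_partition A A k -> #|A| <= k + #|X|./2].

Lemma card_split X Y S : #|X :&: S| <= #|Y :&: S| + #|(X :\: Y) :&: S|.
Proof.
rewrite -(cardsID Y (X :&: S)); apply: leq_add; apply/subset_leq_card/subsetP=> z.
  by rewrite !inE => /andP[/andP[_ ->] ->].
by rewrite !inE => /andP[-> /andP[-> ->]].
Qed.

Lemma setDD_split X Y S : (X :\: Y) :\: S = (X :\: S) :\: (Y :\: S).
Proof. by apply/setP=> z; rewrite !inE; case: (z \in S); rewrite ?andbF. Qed.

(** The [k2] paths that lie inside [U] have at most two vertices each, and only
the path through [w] can contain a further vertex of [U]; the other [k1] paths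
restrict to geodesics outside [U]. *)
Lemma geo_partition_peel A B w X k (U := B :\ w) : leaf A B w -> geo_partition A X k ->
  exists k1 k2, [/\ k = k1 + k2, geo_partition (A :\: U) (X :\: U) k1
                  & #|X :&: U| <= k2.*2 + (w \in X)].
Proof.
move=> lB; have wU : w \notin U by rewrite !inE eqxx.
elim=> [|p {}X {}k gp pX _ [k1 [k2 [-> cov1 le2]]]].
  by exists 0, 0; rewrite set0D set0I cards0; split=> //; apply: geo_partition0.
have split_p := card_split X [set z in p] U.
have [|[q]] := geo_minus_leaf lB gp; rewrite -/U => -[]; first move=> pU sp.
  exists k1, k2.+1; split; first by rewrite addnS.
    suff <- : (X :\: [set z in p]) :\: U = X :\: U by [].
    apply/setP=> z; rewrite setDDl in_setD [in RHS]in_setD in_setU [z \in [set _ in _]]in_set.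
    by case zp: (z \in p); rewrite ?(pU _ zp).
  have wp : w \notin p by apply: contraNN wU; apply: pU.
  rewrite in_setD inE wp /= in le2.
  have : #|[set z in p] :&: U| <= 2.
    apply: leq_trans (subset_leq_card (subsetIl _ _)) _.
    by rewrite cardsE (leq_trans (card_size _)).
  by move: split_p le2; case: (w \in X) => /=; lia.
move=> gq qP leq; exists k1.+1, k2; split; first by rewrite addSn.
  apply: (geo_partitionS gq) => [z zq|].
    have : z \in [set z in p] :\: U by rewrite -qP inE.
    by case/setDP=> zp zU; rewrite in_setD zU pX //; rewrite inE in zp.
  by rewrite qP -setDD_split.
apply: leq_trans split_p _; apply: leq_trans (leq_add leq le2) _.
rewrite in_setD [w \in [set _ in _]]in_set.
case wp: (w \in p); first by rewrite (pX _ wp) addnC addn0.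
by [].
Qed.

(** Deleting [U] destroys no matching edge outside [U] except possibly the one
at [w], which then leaves only [w] uncovered. *)
Lemma matchable_peel A w U X : pendant A w U -> matchable X -> X \subset A ->
  exists Y, [/\ Y \subset X :\: U, matchable Y & #|X :\: U| <= #|Y| + (w \in X)].
Proof.
move=> pU; elim=> [|a b {}X aX bX ab _ IH] sXA.
  by exists set0; rewrite set0D cards0; split=> //; apply: matchable0.
have [aA bA] := (subsetP sXA a aX, subsetP sXA b bX).
have [|Y [sY pmY leY]] := IH; first by rewrite (subset_trans _ sXA) ?subsetDl.
have nab := adj_neq ab.
have sXU : (X :\: [set a; b]) :\: U \subset X :\: U by rewrite setSD ?subsetDl.
have wU := pendant_notin pU.
(* An edge with an end in [U] either lies in [U] or joins [U] to [w]. *)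
case: (boolP ((a \in U) || (b \in U))) => [abU|].
  exists Y; split=> //; first exact: subset_trans sXU.
  have [wab|wab] := boolP (w \in [set a; b]).
    move: leY; rewrite in_setD wab /= addn0 => leY.
    have -> : w \in X by case/set2P: wab => ->.
    rewrite addn1 (cardsD1 w) -add1n leq_add ?leq_b1 //.
    apply: leq_trans leY; apply/subset_leq_card/subsetP=> z.
    rewrite !in_setD !in_set1 in_set2 => /and3P[zw zU zX]; rewrite zU zX negb_or !andbT /=.
    case/orP: abU => [aU|bU].
      have -> : z != a by apply: contraNneq zU => ->.
      have := pendant_adj pU aU bA ab; rewrite in_setU1.
      case/predU1P=> [->//|bU]; by apply: contraNneq zU => ->.
    have -> : z != b by apply: contraNneq zU => ->.
    rewrite adj_sym in ab; have := pendant_adj pU bU aA ab; rewrite in_setU1.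
    case/predU1P=> [->|aU]; rewrite ?zw //; rewrite andbT.
    by apply: contraNneq zU => ->.
  suff -> : X :\: U = (X :\: [set a; b]) :\: U.
    apply: leq_trans leY _; rewrite leq_add2l in_setD wab.
    by case: (w \in X).
  move: wab; rewrite in_set2 negb_or => /andP[wa wb].
  have [aU bU] : a \in U /\ b \in U.
    case/orP: abU => hU.
      by have := pendant_adj pU hU bA ab; rewrite in_setU1 eq_sym (negPf wb); split.
    rewrite adj_sym in ab.
    by have := pendant_adj pU hU aA ab; rewrite in_setU1 eq_sym (negPf wa); split.
  apply/setP=> z; rewrite !in_setD in_set2.
  by case: eqP => [->|_]; rewrite ?aU //; case: eqP => [->|_]; rewrite ?bU.
rewrite negb_or => /andP[aU bU].
have dY : [disjoint [set a; b] & Y].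
  rewrite disjoints_subset; apply/subsetP=> z zab; rewrite inE.
  by apply: contraL zab => /(subsetP sY); rewrite !in_setD => /and3P[].
exists ([set a; b] :|: Y); split.
- rewrite subUset (subset_trans sY sXU) andbT.
  by apply/subsetP=> z /set2P[]->; rewrite in_setD ?aU ?bU.
- apply: (matchableS (a := a) (b := b)); rewrite ?inE ?eqxx ?orbT //.
  by rewrite setDUl setDv set0U (setDidPl _) // disjoint_sym.
have aXU : a \in X :\: U by rewrite in_setD aU.
have bXU : b \in X :\: U by rewrite in_setD bU.
rewrite (card_setD2 aXU bXU nab) cardsU (disjoint_setI0 dY) cards0 subn0 cards2 nab.
rewrite !setDDl [U :|: _]setUC -setDDl.
rewrite -addnA !ltnS; apply: leq_trans leY _; rewrite leq_add2l in_setD.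
by case: (w \in X); rewrite ?andbF ?leq_b1.
Qed.

(** As [U] is an even clique, it adds [#|U|./2] both to the maximum size of a
matching and to the least number of geodesics. *)
Lemma extremal_peel A B w (U := B :\ w) : leaf A B w ->
  extremal A <-> extremal (A :\: U).
Proof.
move=> lB; have [wB pU clB oB _] := lB; rewrite -/U in pU.
have sUA : U \subset A by apply: subset_trans (pendant_sub pU) (subsetDl _ _).
have evU : ~~ odd #|U| by move: oB; rewrite (cardsD1 w) wB.
have pmU' : matchable U by apply: even_clique_matchable evU; apply: clique_sub clB; apply: subsetDl.
have cA : #|A| = #|U| + #|A :\: U| by rewrite -(cardsID U A) (setIidPr sUA).
split=> -[X [sX pmX leX]].
  have [Y [sY pmY leY]] := matchable_peel pU pmX sX.
  exists Y; split=> //; first exact: subset_trans sY (setSD _ sX).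
  move=> k covk; have : geo_partition A A (k + #|U|./2).
    have covk' : geo_partition A (A :\: U) k.
      by apply: geo_partition_mono covk => p; apply: geo_trunk pU.
    rewrite -{2}(setID A U) setUC (setIidPr sUA); apply: geo_partitionU => //.
      exact: matchable_partition.
    by rewrite disjoint_sym; apply/pred0P=> z /=; rewrite in_setD; case: (z \in U).
  move=> /leX; have := matchable_even pmX; have := matchable_even pmY.
  have := cardsID U X; have := subset_leq_card (subsetIr X U).
  by case: (w \in X) leY => /=; lia.
exists (X :|: U); split.
- by rewrite subUset sUA (subset_trans sX) ?subsetDl.
- apply: matchableU => //; rewrite disjoint_sym; apply/pred0P=> z /=.
  by apply/negP => /andP[zU /(subsetP sX)/setDP[_]]; rewrite zU.
move=> k /(geo_partition_peel lB)[k1 [k2 [-> /leX le1]]].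
rewrite (setIidPr sUA) (pendant_root pU) => le2.
have -> : #|X :|: U| = #|X| + #|U|.
  rewrite cardsU (_ : X :&: U = set0) ?cards0 ?subn0 //.
  apply/setP=> z; rewrite in_setI in_set0; apply/negP.
  by case/andP=> /(subsetP sX)/setDP[_ /negPf->].
have := matchable_even pmX; rewrite cA; rewrite -/U in le1, le2.
by lia.
Qed.

End Extremal.

(** * Leaves of rooted sets *)

Section RootedLeaf.
Variable G : sgraph.
Implicit Types (x y z v w a b c r : G) (s t p q : seq G).
Implicit Types (A B C H K Q X Y Z S : {set G}).

(** For odd [H] with [H - v] matchable, the matching edges and the path [v] form
a partition into [(#|H| + 1)/2] geodesics. Tightness says that no partition in
which [v] is an endpoint of its path does better. *)
Definition rooted_tight H v : Prop :=
  forall s k, geodesic H (v :: s) -> geo_partition H (H :\: [set z in v :: s]) k ->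
  #|H| <= k.+1.*2.

Lemma card_setD_seq X p : uniq p -> {subset p <= X} ->
  #|X| = #|X :\: [set z in p]| + size p.
Proof.
move=> up pX; rewrite -(cardsID [set z in p] X) addnC (setIidPr _).
  by rewrite [#|[set _ in _]|]cardsE (card_uniqP up).
by apply/subsetP=> z; rewrite inE => /pX.
Qed.

(** If [a] and [c] were not adjacent, the geodesic [a b c] and the matching of
the rest would save one path. The root is an endpoint in that partition, either
of [a b c], since it is not [b], or of its matching edge. *)
Lemma rooted_tight_P3 H v a b c : rooted_tight H v -> v \in H -> b != v ->
  a \in H -> b \in H -> c \in H -> adj a b -> adj b c -> a != c ->
  matchable (H :\: [set z in [:: a; b; c]]) -> adj a c.
Proof.
move=> tH vH bv aH bH cH ab bc ac; set R := H :\: _ => pmR.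
apply: contraT => nac.
have RH : R \subset H by apply: subsetDl.
have evR := matchable_even pmR.
have cardH : #|H| = #|R| + 3.
  apply: (card_setD_seq (p := [:: a; b; c])).
    by rewrite /= !inE negb_or (adj_neq ab) ac (adj_neq bc).
  by move=> z; rewrite !inE => /or3P[]/eqP->.
have g3 := geo3 aH bH cH ab bc nac ac.
have [eva|va] := eqVneq v a.
  subst v; move: evR cardH (tH _ _ g3 (matchable_partition pmR RH)).
  by card_lia.
have [evc|vc] := eqVneq v c.
  subst v; have g3' : geodesic H [:: c; b; a].
    by apply: geo3; rewrite // 1?adj_sym // eq_sym.
  have := tH _ _ g3'; rewrite (_ : H :\: _ = R); last first.
    by apply/setP=> z; rewrite !inE orbCA orbA orbC orbCA.
  by move=> /(_ _ (matchable_partition pmR RH)); move: evR cardH; card_lia.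
have vR : v \in R by rewrite !inE !negb_or va vc eq_sym bv.
have [u [uR vu pmR']] := matchable_partner pmR vR.
have uH := subsetP RH u uR.
have := tH [:: u] (#|R :\: [set v; u]|./2).+1 (geo2 vH uH vu).
rewrite cardH (card_setD2 vR uR (adj_neq vu)).
have evR' := matchable_even pmR'.
suff c3 : geo_partition H (H :\: [set z in [:: v; u]]) (#|R :\: [set v; u]|./2).+1.
  by move=> /(_ c3); move: evR'; card_lia.
apply: (geo_partitionS g3) => [z|].
  rewrite !inE => zabc; apply/andP; split; last by case/or3P: zabc => /eqP->.
  apply: contraL zabc => /orP[]/eqP-> {z}.
    by move: vR; rewrite !inE => /andP[].
  by move: uR; rewrite !inE => /andP[].
have -> : H :\: [set z in [:: v; u]] :\: [set z in [:: a; b; c]] = R :\: [set v; u].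
  by rewrite /R; apply/setP=> z; rewrite !inE andbCA.
by apply: matchable_partition => //; apply: subset_trans RH; apply: subsetDl.
Qed.

Section Core.
Variables (H K : {set G}) (v : G).
Hypotheses (tH : rooted_tight H v) (vK : v \in K) (KH : K \subset H).
Hypotheses (clK : clique K) (oddK : odd #|K|) (pmHK : matchable (H :\: K)).

Let vH : v \in H := subsetP KH v vK.
Let KinH x : x \in K -> x \in H := subsetP KH x.

Lemma core_matchable x X : x \in K -> X \subset K -> ~~ odd #|X| -> matchable X.
Proof. by move=> xK XK; apply: even_clique_matchable; apply: clique_sub clK. Qed.

(** The fundamental exchange. The set [K - x] has a perfect matching because [K]
is an odd clique, so [q r s] can be compared with a perfect matching of the
rest of [H]. *)
Lemma core_twin x (q r s : G) : x \in K -> q \in x |: (H :\: K) -> r \in H :\: K ->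
    s \in (x |: (H :\: K)) :\ q -> adj q r -> adj r s ->
    matchable ((x |: (H :\: K)) :\ q :\: [set r; s]) ->
  adj q s.
Proof.
move=> xK qZ rH sZ qr rs pmZ.
have rK : r \notin K by case/setDP: rH.
have ZH z : z \in x |: (H :\: K) -> z \in H.
  by rewrite !inE => /predU1P[->|/andP[_ //]]; apply: KinH.
have [sq {}sZ] : s != q /\ s \in x |: (H :\: K) by move/setD1P: sZ.
apply: (rooted_tight_P3 tH (b := r)) => //; first by apply: contraNneq rK => ->.
- exact: ZH.
- by case/setDP: rH.
- exact: ZH.
- by rewrite eq_sym.
have pmKx : matchable (K :\ x).
  apply: (core_matchable xK); first exact: subsetDl.
  by move: oddK; rewrite (cardsD1 x) xK.
suff -> : H :\: [set z in [:: q; r; s]] =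
    (K :\ x) :|: ((x |: (H :\: K)) :\ q :\: [set r; s]).
  apply: matchableU => //; apply/pred0P=> z; rewrite !inE.
  by case: (z == x); case: (z \in K); rewrite /= ?andbF.
apply/setP=> z; rewrite !inE !negb_or.
case: (eqVneq z x) => [->|zx] /=.
  by rewrite KinH //; case: (x == q); case: (x == r); case: (x == s).
case zK: (z \in K) => /=; last by case: (z == q); case: (z == r); case: (z == s).
have notin u : u \in x |: (H :\: K) -> (z == u) = false.
  rewrite !inE => /predU1P[->|/andP[uK _]]; first exact: negPf.
  by apply: contraNF uK => /eqP<-.
have zr : (z == r) = false by apply: contraNF rK => /eqP<-.
by rewrite (notin q) // (notin s) // zr KinH.
Qed.

(** The uncovered vertex travels: if [q] can be left uncovered in [x + (H - K)],
so can each neighbour [r] of [q] outside [K], by exchanging the edges [rs] and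
[qs]. *)
Lemma core_step x (q r : G) : x \in K -> q \in x |: (H :\: K) -> r \in H :\: K ->
  adj q r -> matchable ((x |: (H :\: K)) :\ q) -> matchable ((x |: (H :\: K)) :\ r).
Proof.
move=> xK qZ rH qr pmq.
have rq : r \in (x |: (H :\: K)) :\ q.
  by rewrite in_setD1 in_setU1 rH orbT eq_sym adj_neq.
have [s [sZ rs pmrs]] := matchable_partner pmq rq.
have qs := core_twin xK qZ rH sZ qr rs pmrs.
have sr : s != r by rewrite eq_sym adj_neq.
have [sq sZ'] := setD1P sZ.
apply: (matchableS (a := q) (b := s)); rewrite // ?in_setD1 ?sr ?(adj_neq qr) //.
suff -> : (x |: (H :\: K)) :\ r :\: [set q; s] = (x |: (H :\: K)) :\ q :\: [set r; s].
  by [].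
by apply/setP=> z; rewrite !inE !negb_or;
  case: (z == q); case: (z == r); case: (z == s); rewrite /= ?andbF.
Qed.

Lemma core_start x r : x \in K -> r \in H :\: K -> adj x r ->
  matchable ((x |: (H :\: K)) :\ r).
Proof.
move=> xK rH xr; apply: core_step (setU11 _ _) rH xr _ => //.
by rewrite setU1K // in_setD xK.
Qed.

(** Since [K - {x, y, z}] is an even clique, the path [z y a] has a perfectly
matched complement in [H]. The centre [y] has to differ from the root. *)
Lemma core_spread x y z a : x \in K -> y \in K -> z \in K -> x != y -> y != v ->
  z != x -> a \in H :\: K -> adj y a -> matchable ((x |: (H :\: K)) :\ a) -> adj z a.
Proof.
move=> xK yK zK xy yv zx aH ya pma.
have [->//|zy] := eqVneq z y.
have aK : a \notin K by case/setDP: aH.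
apply: (rooted_tight_P3 tH (b := y)) => //.
- exact: KinH.
- exact: KinH.
- by case/setDP: aH.
- exact: (clK zK yK zy).
- by apply: contraNneq aK => <-.
suff -> : H :\: [set u in [:: z; y; a]] =
    (K :\ x :\: [set y; z]) :|: ((x |: (H :\: K)) :\ a).
  apply: matchableU => //.
    apply: (core_matchable xK); first by rewrite setDDl subsetDl.
    have yKx : y \in K :\ x by rewrite !inE eq_sym xy.
    have zKx : z \in K :\ x by rewrite !inE zx.
    move: oddK; rewrite (cardsD1 x) xK (card_setD2 yKx zKx) 1?eq_sym //.
    by rewrite /= negbK.
  apply/pred0P=> u; rewrite !inE.
  by case: (u == x); case: (u \in K); rewrite /= ?andbF.
apply/setP=> u; rewrite !inE !negb_or.
have [->|ux] := eqVneq u x.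
  by rewrite [x == z]eq_sym (negPf zx) (negPf xy) KinH //= !andbT.
case uK: (u \in K) => /=.
  have -> : (u == a) = false by apply: contraNF aK => /eqP<-.
  by rewrite KinH // !andbT !orbF andbC.
have -> : (u == z) = false by apply: contraFF uK => /eqP->.
have -> : (u == y) = false by apply: contraFF uK => /eqP->.
by rewrite andbF.
Qed.

Hypothesis maxK : forall a, a \in H :\: K -> exists2 x, x \in K & ~~ adj x a.

(** Suppose that [x] and [y] are different. Leaving uncovered first [r] and then,
moving through the component, [r'], one finds by [core_spread] that [r'] is
adjacent to all of [K] except perhaps [x], and by a second application, with a
third vertex of [K] in the role of [x], to [x] as well. This contradicts the
maximality of [K]. *)
Lemma core_attach x y r r' : x \in K -> y \in K -> adj x r -> adj y r' ->
  r \in H :\: K -> connect (radj (H :\: K)) r r' -> x = y.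
Proof.
(* [core_spread] needs a centre [y] that differs from the root. *)
wlog yv : x y r r' / y != v => [hwlog xK yK xr yr' rH rr'|].
  have r'H : r' \in H :\: K by apply: (subsetP (component_sub rH)); rewrite inE.
  have [yv|/hwlog yv] := eqVneq y v; last exact: (yv x r r').
  have [->//|xv] := eqVneq x v; apply/esym.
  by apply: (hwlog y x r' r) => //; rewrite connect_radj_sym.
move=> xK yK xr yr' rH rr'; apply/eqP; apply: contraT => xy.
have r'H : r' \in H :\: K.
  by apply: (subsetP (component_sub rH)); rewrite inE.
have pmr' : matchable ((x |: (H :\: K)) :\ r').
  apply: (connect_radj_ind (P := fun u => matchable ((x |: (H :\: K)) :\ u)) rr').
    move=> a b aH bH ab; apply: core_step => //.
    by rewrite in_setU1 aH orbT.
  exact: core_start.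
have spread z : z \in K -> z != x -> adj z r'.
  by move=> zK zx; apply: (core_spread xK yK) pmr'.
have [z] : exists z, z \in K :\ x :\ y.
  apply/set0Pn; apply: contraTneq oddK => K0.
  by rewrite (cardsD1 x) xK (cardsD1 y) !inE eq_sym xy yK K0 cards0.
rewrite !inE => /and3P[zy zx zK].
(* The vertex [z] now plays the role that [x] had in [spread]. *)
have xr' : adj x r'.
  apply: (core_spread zK yK xK) => //; first by rewrite eq_sym.
  by apply: core_start => //; apply: spread.
have [u uK] := maxK r'H.
by have [->|/spread->//] := eqVneq u x; rewrite xr'.
Qed.

(** A partition of [Q + x] rooted at [x] extends to one of [H] rooted at [v]. If
[x] is [v], add a perfect matching of the rest. Otherwise pick a third vertex
[y] of [K], continue the path that ends at [x] to [y], make [v] a path of its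
own, and match the rest, which is possible as [K - {x, y, v}] is even. *)
Lemma core_branch_tight x Q : x \in K -> pendant H x Q -> Q \subset H :\: K ->
    1 < #|K| ->
  rooted_tight (x |: Q) x.
Proof.
move=> xK pQ QH K1 s k gs covs.
have QK z : z \in Q -> z \notin K by move=> /(subsetP QH)/setDP[].
have xQ : x \notin Q by apply/negP => /QK; rewrite xK.
have pmR : matchable (H :\: K :\: Q).
  apply: matchable_restrict pmHK _ _; first exact: subsetDl.
  move=> a b /setDP[aH aQ] bH ab; rewrite in_setD bH andbT.
  apply: contraNN aQ => bQ; rewrite adj_sym in ab.
  have := pendant_adj pQ bQ _ ab; rewrite in_setU1.
  case/setDP: (aH) => aH' aK /(_ aH')/predU1P[ax|//].
  by rewrite ax xK in aK.
have liftc X l : geo_partition (x |: Q) X l -> geo_partition H X l.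
  by apply: geo_partition_mono => p; apply: geo_branch pQ.
have sQ : {subset x :: s <= x |: Q} by move=> z; apply: geo_mem.
have cardR : #|H| = #|K| + (#|Q| + #|H :\: K :\: Q|).
  by rewrite -(cardsID K H) (setIidPr KH) -(cardsID Q (H :\: K)) (setIidPr QH).
have evR := matchable_even pmR; have evQ : ~~ odd #|Q|.
  by have := matchable_even pmHK; rewrite -(cardsID Q) (setIidPr QH) oddD (negPf evR) addbF.
rewrite cardsU1 xQ.
have QKH z : (z \in Q) ==> (z \notin K) && (z \in H).
  by apply/implyP=> /(subsetP QH)/setDP[-> ->].
have KinHb z : (z \in K) ==> (z \in H) by apply/implyP/KinH.
have sQb z : (z \in s) ==> (z == x) || (z \in Q).
  by apply/implyP=> zs; rewrite -in_setU1; apply: sQ; rewrite inE zs orbT.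
have [xv|xv] := eqVneq x v.
  subst x; set T := K :\ v :|: (H :\: K :\: Q).
  have TH : T \subset H.
    by rewrite subUset (subset_trans (subsetDl _ _) KH) setDDl subsetDl.
  have dT : [disjoint K :\ v & H :\: K :\: Q].
    by apply/pred0P=> z; rewrite !inE; case: (z \in K); rewrite /= ?andbF.
  have evKv : ~~ odd #|K :\ v| by move: oddK; rewrite (cardsD1 v) vK.
  have pmT : matchable T by apply: matchableU (core_matchable vK _ evKv) pmR dT; apply: subsetDl.
  have dQT : [disjoint (v |: Q) :\: [set z in v :: s] & T].
    apply/pred0P=> z; rewrite !inE; case: eqVneq => [->|zv] //=.
    by have := QKH z; case: (z \in Q); case: (z \in K); rewrite /= ?andbF.
  have := tH (geo_branch pQ gs).
  have -> : H :\: [set z in v :: s] = ((v |: Q) :\: [set z in v :: s]) :|: T.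
    apply/setP=> z; rewrite !inE; have := sQb z; have := QKH z; have := KinHb z.
    by case: eqVneq => [->|zv]; rewrite ?vK /= ?andbF //; case: (z \in s);
       case: (z \in Q); case: (z \in K); case: (z \in H).
  move=> /(_ _ (geo_partitionU (liftc _ _ covs) (matchable_partition pmT TH) dQT)).
  rewrite cardR cardsU (disjoint_setI0 dT) cards0 (cardsD1 v) vK.
  by move: evR evQ evKv; card_lia.
have [y] : exists y, y \in K :\ x :\ v.
  apply/set0Pn; apply: contraTneq oddK => K0.
  by rewrite (cardsD1 x) xK (cardsD1 v) !inE eq_sym xv vK K0 cards0.
rewrite !inE => /and3P[yv yx yK].
have vKx : v \in K :\ x by rewrite !inE eq_sym xv.
have yKx : y \in K :\ x by rewrite !inE yx.
set T := K :\ x :\: [set v; y] :|: (H :\: K :\: Q).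
have TH : T \subset H.
  by rewrite subUset !setDDl (subset_trans (subsetDl _ _) KH) subsetDl.
have dT : [disjoint K :\ x :\: [set v; y] & H :\: K :\: Q].
  by apply/pred0P=> z; rewrite !inE; case: (z \in K); rewrite /= ?andbF.
have vy : v != y by rewrite eq_sym.
have cK : #|K| = #|K :\ x :\: [set v; y]| + 3.
  by rewrite (cardsD1 x) xK (card_setD2 vKx yKx vy) addnC addn1 -addn3.
have evT : ~~ odd #|K :\ x :\: [set v; y]|.
  by move: oddK; rewrite cK oddD /= addbT.
have pmT : matchable T.
  by apply: matchableU (core_matchable vK _ evT) pmR dT; rewrite setDDl subsetDl.
have dQT : [disjoint (x |: Q) :\: [set z in x :: s] & T].
  apply/pred0P=> z; rewrite !inE; case: eqVneq => [->|zx] //=.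
  by have := QKH z; case: (z \in Q); case: (z \in K); rewrite /= ?andbF.
have yQ : y \notin x |: Q.
  by rewrite in_setU1 (negPf yx) /=; apply: contraTN yK => /QK.
have xy : x != y by rewrite eq_sym.
have gy := geo_extend pQ gs (KinH yK) yQ (clK xK yK xy).
have := @tH [::] (k + #|T|./2).+1 (geo1 vH).
suff cT : geo_partition H (H :\: [set z in [:: v]]) (k + #|T|./2).+1.
  move=> /(_ cT); rewrite cardR cardsU (disjoint_setI0 dT) cards0 cK.
  by move: evR evQ evT; card_lia.
have vQ : v \notin x |: Q.
  by rewrite in_setU1 eq_sym (negPf xv) /=; apply: contraTN vK => /QK.
apply: (geo_partitionS gy) => [z zs|].
  rewrite !in_setD [z \in [set _ in [:: v]]]in_set mem_seq1 (geo_mem gy zs) andbT.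
  move: zs; rewrite in_cons => /predU1P[->//|/sQ zQ].
  by apply: contraTneq zQ => ->.
suff -> : H :\: [set z in [:: v]] :\: [set z in [:: y, x & s]] =
    ((x |: Q) :\: [set z in x :: s]) :|: T.
  by apply: geo_partitionU dQT; [apply: (liftc _ _ covs) | apply: matchable_partition].
apply/setP=> z; rewrite !inE.
have := sQb z; have := QKH z; have := KinHb z.
have [->|zx] := eqVneq z x; first by rewrite xK /= ?orbT ?andbF.
have [->|zv] := eqVneq z v.
  have -> : (v \in Q) = false by apply: contraNF vQ => vQ; rewrite in_setU1 vQ orbT.
  by rewrite vK /= ?andbF.
have [->|zy] := eqVneq z y.
  have -> : (y \in Q) = false by apply: contraNF yQ => yQ; rewrite in_setU1 yQ orbT.
  by rewrite yK /= ?andbF.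
rewrite /=; by case: (z \in s); case: (z \in Q); case: (z \in K); case: (z \in H).
Qed.

End Core.

Lemma leaf_branch A x C B w : pendant A x C -> leaf (x |: C) B w -> x \notin B :\ w ->
  leaf A B w.
Proof. by move=> pC [wB pB clB oB B1] xB; split=> //; apply: pendant_trans pC pB xB. Qed.

(** Enlarge the clique as long as some vertex outside is adjacent to all of it:
by [core_twin] the partner of that vertex in the matching is adjacent to all of
it, too. *)
Lemma exists_max_core H v : rooted_tight H v -> v \in H -> matchable (H :\ v) ->
  exists K, [/\ v \in K, K \subset H, clique K & odd #|K|] /\ matchable (H :\: K) /\
    forall a, a \in H :\: K -> exists2 x, x \in K & ~~ adj x a.
Proof.
move=> tH vH pmv.
suff main n K : v \in K -> K \subset H -> clique K -> odd #|K| -> matchable (H :\: K) ->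
    #|H :\: K| < n -> exists K,
    [/\ v \in K, K \subset H, clique K & odd #|K|] /\ matchable (H :\: K) /\
    forall a, a \in H :\: K -> exists2 x, x \in K & ~~ adj x a.
  apply: (main _ [set v]) (ltnSn _); rewrite ?set11 ?sub1set ?cards1 //.
  by move=> x y /set1P-> /set1P->; rewrite eqxx.
elim: n K => // n IH K vK KH clK oddK pmHK ltn.
have [/exists_inP[a aHK /forall_inP Ka]|/exists_inPn maxK] :=
    boolP [exists a in H :\: K, [forall x in K, adj x a]]; last first.
  exists K; split=> //; split=> // a /maxK; rewrite negb_forall_in.
  by move=> /exists_inP[x xK nxa]; exists x.
have [b [bHK ab pmR]] := matchable_partner pmHK aHK.
have nab := adj_neq ab.
have [aH aK] := setDP aHK; have [bH bK] := setDP bHK.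
have Kb x : x \in K -> adj x b.
  move=> xK; have ZE : (x |: (H :\: K)) :\ x = H :\: K.
    by rewrite setU1K // in_setD xK.
  by apply: (core_twin tH vK KH clK oddK xK _ aHK _ (Ka x xK) ab); rewrite ?ZE ?setU11.
apply: (IH (K :|: [set a; b])).
- by rewrite inE vK.
- by rewrite subUset KH; apply/subsetP=> z /set2P[]->.
- move=> x y; rewrite !inE.
  case/or3P=> [xK|/eqP->|/eqP->]; case/or3P=> [yK|/eqP->|/eqP->]; rewrite ?eqxx //.
  + exact: clK.
  + by move=> _; apply: Ka.
  + by move=> _; apply: Kb.
  + by move=> _; rewrite adj_sym; apply: Ka.
  + by move=> _; rewrite adj_sym; apply: Kb.
  by move=> _; rewrite adj_sym.
- rewrite cardsU (_ : K :&: [set a; b] = set0) ?cards0 ?subn0 ?cards2 ?nab ?oddD ?oddK //.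
  apply/setP=> z; rewrite !inE; apply/negP=> /andP[zK /orP[]/eqP ez]; subst z.
    by rewrite zK in aK.
  by rewrite zK in bK.
- by rewrite -setDDl.
rewrite -setDDl; move: ltn; rewrite (card_setD2 aHK bHK nab).
by move=> ltn; apply: ltnW.
Qed.

(** Either [H] is the maximal core [K] itself, or a component of [H - K] together
with its only attachment [x] is a smaller instance with root [x]. The root is
kept off [B :\ w] so that a leaf of the branch is a leaf of [H]. *)
Theorem rooted_leaf H v :
    connected_in H -> v \in H -> matchable (H :\ v) -> rooted_tight H v ->
  1 < #|H| -> exists B w, leaf H B w /\ v \notin B :\ w.
Proof.
have [n] := ubnP #|H|; elim: n H v => // n IH H v ltn cH vH pmv tH H1.
have [K [[vK KH clK oddK] [pmHK maxK]]] := exists_max_core tH vH pmv.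
have [HK|[r0 r0HK]] := set_0Vmem (H :\: K).
  have eHK : H = K by apply/eqP; rewrite eqEsubset KH -setD_eq0 HK eqxx.
  exists K, v; rewrite eHK !inE eqxx; split=> //.
  split=> //; last by rewrite -eHK.
  split=> // x y; rewrite !inE => /andP[_ _] yK _; rewrite yK andbT.
  by case: eqP.
have [x [r [xK rHK xr]]] : exists x r, [/\ x \in K, r \in H :\: K & adj x r].
  have : ~~ (H \subset K).
    by apply/subsetPn; case/setDP: r0HK => r0H r0K; exists r0.
  have [/existsP[x /existsP[r /and3P[xK rHK xr]]] _|none] :=
      boolP [exists x, exists r, [&& x \in K, r \in H :\: K & adj x r]].
    by exists x, r.
  case/negP; apply: (conn_closed cH vH vK) => a b aH bH ab aK.
  apply: contraNT none => bK; apply/existsP; exists a; apply/existsP; exists b.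
  by rewrite aK in_setD bK bH.
set Q := component (H :\: K) r.
have QHK : Q \subset H :\: K by apply: component_sub.
have pQ : pendant H x Q.
  split; first exact: (subsetP KH).
    apply: subset_trans QHK _; apply/subsetP=> z /setDP[zH zK].
    by rewrite in_setD1 zH andbT; apply: contraNneq zK => ->.
  move=> y z yQ zH yz; rewrite in_setU1.
  case: (boolP (z \in K)) => zK; last first.
    by rewrite (component_closed _ yQ) ?orbT // in_setD zK.
  rewrite (_ : z = x) ?eqxx //; rewrite adj_sym in yz.
  apply/esym; apply: (core_attach tH vK KH clK oddK pmHK maxK xK zK xr yz rHK).
  by rewrite inE in yQ.
have K1 : 1 < #|K|.
  rewrite ltnNge; apply/negP => /card_le1_eqP K1.
  by have [y yK] := maxK r rHK; rewrite (K1 x y xK yK) xr.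
have xQ := pendant_notin pQ.
have cQ : #|x |: Q| < #|H|.
  apply: proper_card; rewrite properE (pendant_branch_sub pQ) /=.
  have [y] : exists y, y \in K :\ x.
    by apply/card_gt0P; move: K1; rewrite (cardsD1 x) xK.
  rewrite in_setD1 => /andP[yx yK]; apply/subsetPn; exists y; first exact: (subsetP KH).
  rewrite in_setU1 (negPf yx) /=; apply/negP => /(subsetP QHK).
  by rewrite in_setD yK.
have pmQ : matchable Q by apply: matchable_restrict pmHK QHK (component_closed rHK).
have tQ := core_branch_tight tH vK KH clK oddK pmHK xK pQ QHK K1.
have [||||B [w [lB xB]]] := IH (x |: Q) x _ _ (setU11 _ _) _ tQ.
- by apply: leq_trans cQ _; rewrite -ltnS.
- exact: conn_branch cH.
- by rewrite setU1K.
- rewrite cardsU1 xQ ltnS card_gt0; apply/set0Pn; exists r; exact: component_refl.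
exists B, w; split; first exact: leaf_branch lB xB.
apply/negP => vB; have := subsetP (pendant_sub (leaf_pendant lB)) v vB.
rewrite in_setD1 in_setU1 => /andP[_ /predU1P[vx|/(subsetP QHK)/setDP[_]]].
  by rewrite -vx vB in xB.
by rewrite vK.
Qed.

End RootedLeaf.

(** * Maximum matchings of extremal sets *)

Section MaximumMatching.
Variable G : sgraph.
Implicit Types (x y z v w a b c r u : G) (s t p q : seq G).
Implicit Types (A B C D H K Q X Y Z S : {set G}).

(** The family of paths that a matching of [Z] provides. *)
Lemma geo_partition_matchable A Y Z : matchable Y -> Y \subset Z -> Z \subset A ->
  geo_partition A Z (#|Y|./2 + #|Z :\: Y|).
Proof.
move=> pmY YZ ZA; have {1}<- : Y :|: (Z :\: Y) = Z.
  apply/setP=> z; rewrite !inE; case zY: (z \in Y) => //=.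
  by rewrite (subsetP YZ).
apply: geo_partitionU; first exact: matchable_partition (subset_trans YZ ZA).
  exact: geo_partition_singletons (subset_trans (subsetDl _ _) ZA).
by apply/pred0P=> z; rewrite /= in_setD; case: (z \in Y).
Qed.

(* [X] is covered by a maximum matching that witnesses the extremality of [A]. *)
Section Tight.
Variables A X : {set G}.
Hypotheses (XA : X \subset A) (pmX : matchable X).
Hypothesis leX : forall k, geo_partition A A k -> #|A| <= k + #|X|./2.

Lemma tight_max Y : matchable Y -> Y \subset A -> #|Y| <= #|X|.
Proof.
move=> pmY YA; have := leX (geo_partition_matchable pmY YA (subxx A)).
have := cardsID Y A; rewrite (setIidPr YA).
by have := matchable_even pmX; have := matchable_even pmY; card_lia.
Qed.

(** Otherwise the path [x a b], the matching of [Y :\: [set a; b]] and the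
remaining single vertices would be too few geodesics. *)
Lemma tight_twin Y x a b : Y \subset A -> #|Y| = #|X| -> x \in A -> x \notin Y ->
  a \in Y -> b \in Y -> adj x a -> adj a b -> matchable (Y :\: [set a; b]) -> adj x b.
Proof.
move=> YA cY xA xY aY bY xa ab pmY; apply: contraT => nxb.
have xb : x != b by apply: contraNneq xY => ->.
have aA := subsetP YA a aY; have bA := subsetP YA b bY.
have g3 := geo3 xA aA bA xa ab nxb xb.
have pA : {subset [:: x; a; b] <= A} by move=> z; apply: geo_mem g3.
have sub : Y :\: [set a; b] \subset A :\: [set z in [:: x; a; b]].
  apply/subsetP=> z; rewrite !inE !negb_or => /andP[/andP[-> ->] zY].
  by rewrite (subsetP YA) // !andbT; apply: contraNneq xY => <-.
have := leX (geo_partitionS g3 pA (geo_partition_matchable pmY sub (subsetDl _ _))).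
have := card_setD_seq (geo_uniq g3) pA.
have := cardsID (Y :\: [set a; b]) (A :\: [set z in [:: x; a; b]]).
rewrite (setIidPr sub) -cY (card_setD2 aY bY (adj_neq ab)) /=.
by have := matchable_even pmY; card_lia.
Qed.

(** Let [v] be uncovered and suppose that a second vertex is. By [tight_twin] the
second uncovered vertex can move to each of its neighbours, which must be
covered as the matching has maximum size. Since [A] is connected it would reach
[v]. *)
Lemma tight_near_perfect : connected_in A ->
  matchable A \/ exists2 v, v \in A & matchable (A :\ v).
Proof.
move=> cA; have [AX|[v /setDP[vA vX]]] := set_0Vmem (A :\: X).
  by left; rewrite (_ : A = X) //; apply/eqP; rewrite eqEsubset XA -setD_eq0 AX eqxx.
have [Av|[u]] := set_0Vmem (A :\: X :\ v).
  right; exists v => //; rewrite (_ : A :\ v = X) //; apply/setP=> z.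
  move/setP/(_ z): Av; rewrite !inE; case: (eqVneq z v) => [->|_] /=.
    by rewrite (negPf vX).
  by case zX: (z \in X) => //= _; rewrite (subsetP XA).
rewrite !inE => /and3P[uv uX uA].
(* [P z]: some maximum matching misses both [z] and [v]. *)
pose P z := z != v /\
  exists Y, [/\ Y \subset A, matchable Y, #|Y| = #|X|, z \notin Y & v \notin Y].
have [_ uvA] := connected_inP _ cA.
suff [] : P v by rewrite eqxx.
apply: (connect_radj_ind (uvA u v uA vA)); last by split=> //; exists X.
move=> x y xA yA xy [xv [Y [YA pmY cY xY vY]]].
have pm_aug z : z \in A -> z \notin Y -> ~~ adj x z.
  move=> zA zY; apply/negP => xz.
  have dY : [disjoint [set x; z] & Y].
    by rewrite disjoints_subset; apply/subsetP=> t /set2P[]->; rewrite inE.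
  have : #|[set x; z] :|: Y| <= #|X|.
    apply: tight_max; last first.
      by rewrite subUset YA andbT; apply/subsetP=> t /set2P[]->.
    apply: (matchableS (a := x) (b := z)); rewrite ?inE ?eqxx ?orbT //.
    by rewrite setDUl setDv set0U (setDidPl _) // disjoint_sym.
  by rewrite cardsU (disjoint_setI0 dY) cards0 cards2 (adj_neq xz) cY subn0 /=; card_lia.
have yY : y \in Y by apply: contraLR xy => /(pm_aug y yA).
have yv : y != v by apply: contraNneq vY => <-.
have [b [bY yb pmYb]] := matchable_partner pmY yY.
have xb := tight_twin YA cY xA xY yY bY xy yb pmYb.
have [xy' xb'] := (adj_neq xy, adj_neq xb).
split=> //; exists (x |: Y :\ y); split.
- rewrite subUset sub1set xA (subset_trans (subsetDl _ _)) //.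
- apply: (matchableS (a := x) (b := b)); rewrite ?inE ?eqxx ?bY ?andbT //.
    by rewrite [b == y]eq_sym (adj_neq yb) orbT.
  suff -> : (x |: Y :\ y) :\: [set x; b] = Y :\: [set y; b] by [].
  apply/setP=> z; rewrite !inE !negb_or; case: (eqVneq z x) => [->|_] /=.
    by rewrite (negPf xY) andbF.
  by rewrite andbA [_ && (z != y)]andbC.
- by rewrite cardsU1 !inE (negPf xY) andbF -cY (cardsD1 y Y) yY.
- by rewrite !inE eqxx orbF eq_sym.
by rewrite !inE eq_sym negb_or xv (negPf vY) andbF.
Qed.

Lemma tight_rooted v : v \in A -> matchable (A :\ v) -> rooted_tight A v.
Proof.
move=> vA pmv s k gs covs; have := leX (geo_partitionS gs (fun z => geo_mem gs) covs).
have := matchable_even pmv; have := matchable_even pmX; have := subset_leq_card XA.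
by rewrite (cardsD1 v A) vA; card_lia.
Qed.

(** A path of [v |: C] that ends at [v] can be continued to the partner [b] of
[v], which lies on the other side of the cut-vertex. *)
Lemma tight_branch v b C : pendant A v C -> b \in A -> b \notin v |: C ->
  adj v b -> matchable (A :\: [set v; b]) -> rooted_tight (v |: C) v.
Proof.
move=> pC bA bC vb pmR s k gs covs; have vA := pendant_root pC.
have sA := pendant_branch_sub pC; have vC := pendant_notin pC.
set T := A :\: (v |: C) :\ b.
have pmT : matchable T.
  apply: matchable_restrict pmR _ _.
    by apply/subsetP=> z; rewrite !inE !negb_or => /and3P[-> /andP[-> _] ->].
  move=> y z; rewrite !inE !negb_or => /and3P[yb /andP[yv yC] yA].
  move=> /andP[/andP[zv zb] zA] yz; rewrite zb zv zA /= andbT.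
  apply/negP=> zC; rewrite adj_sym in yz.
  by have := pendant_adj pC zC yA yz; rewrite in_setU1 (negPf yv) (negPf yC).
have TA : T \subset A by rewrite /T setDDl subsetDl.
have dT : [disjoint (v |: C) :\: [set z in v :: s] & T].
  rewrite disjoints_subset; apply/subsetP=> z /setDP[zC _].
  by rewrite in_setC in_setD1 in_setD zC andbF.
have gb := geo_extend pC gs bA bC vb.
have gsC z : z \in v :: s -> z \in v |: C by apply: geo_mem gs.
have covT : geo_partition A (A :\: [set z in [:: b, v & s]]) (k + #|T|./2).
  suff -> : A :\: [set z in [:: b, v & s]] = ((v |: C) :\: [set z in v :: s]) :|: T.
    apply: geo_partitionU dT; last exact: matchable_partition.
    by apply: geo_partition_mono covs => p; apply: geo_branch pC.
  apply/setP=> z; rewrite !inE.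
  have [->|zb] /= := eqVneq z b; first by move: bC; rewrite !inE => /negPf->; rewrite andbF.
  have /implyP := gsC z; rewrite !inE.
  have /implyP := subsetP sA z; rewrite !inE.
  by case: (_ || (z \in s)); case: (z \in A); case: (_ || _).
have := leX (geo_partitionS gb (fun z => geo_mem gb) covT).
have : #|A| = #|v |: C| + #|T|.+1.
  rewrite -(cardsID (v |: C) A) (setIidPr sA) (cardsD1 b (A :\: _)).
  by rewrite in_setD bC bA.
have evR := matchable_even pmR; rewrite cardsU1 vC.
have vb' := adj_neq vb; move: evR; rewrite (card_setD2 vA bA vb').
have := matchable_even pmX; have := matchable_even pmT; have := subset_leq_card XA.
by rewrite (card_setD2 vA bA vb'); card_lia.
Qed.

End Tight.

(** If a matching misses one vertex, that vertex is a root of all of [A]. In a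
perfect matching, all components of [A - v] but the one of the partner of the
cut-vertex [v] are perfectly matched, so each of them is a branch rooted at
[v]. *)
Lemma extremal_leaf A : connected_in A -> extremal A -> ~~ biconnected_in A ->
  exists B w, leaf A B w.
Proof.
move=> cA [X [XA pmX leX]] nbA.
have : exists2 v, v \in A & (A :\ v != set0) && ~~ connected_in (A :\ v).
  move: nbA; rewrite negb_and cA /= => /forall_inPn[v vA].
  by rewrite negb_or => vP; exists v.
case=> v vA /andP[Av ncAv].
have A1 : 1 < #|A| by rewrite (cardsD1 v) vA ltnS card_gt0.
have [pmA|[r rA pmr]] := tight_near_perfect XA pmX leX cA; last first.
  have [//|B [w [lB _]]] := rooted_leaf cA rA pmr (tight_rooted XA pmX leX rA pmr).
  by exists B, w.
have [b [bA vb pmvb]] := matchable_partner pmA vA.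
have vb' := adj_neq vb.
have bAv : b \in A :\ v by rewrite in_setD1 bA eq_sym vb'.
have [y yAv yb] : exists2 y, y \in A :\ v & ~~ connect (radj (A :\ v)) b y.
  apply/exists_inP; apply: contraNT ncAv; rewrite negb_exists_in => /forall_inP all_b.
  apply/connected_inP; split=> // y z /all_b/negPn yb /all_b/negPn zb.
  by apply: connect_trans zb; rewrite connect_radj_sym.
set C := component (A :\ v) y.
have pC : pendant A v C by apply: pendant_component.
have CAv : C \subset A :\ v by apply: component_sub.
have bC : b \notin C by rewrite inE connect_radj_sym.
have bvC : b \notin v |: C by rewrite in_setU1 negb_or eq_sym vb'.
have tC := tight_branch XA pmX leX pC bA bvC vb pmvb.
have pmC : matchable C.
  apply: matchable_restrict pmvb _ _.
    apply/subsetP=> z zC; have /setD1P[zv zA] := subsetP CAv z zC.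
    by rewrite !inE negb_or zv zA andbT; apply: contraNneq bC => <-.
  move=> z t zC /setDP[tA]; rewrite in_set2 negb_or => /andP[tv _] zt.
  by have := pendant_adj pC zC tA zt; rewrite in_setU1 (negPf tv).
have [||||B [w [lB vB]]] := rooted_leaf _ _ _ tC.
- exact: conn_branch cA.
- exact: setU11.
- by rewrite setU1K // (pendant_notin pC).
- rewrite cardsU1 (pendant_notin pC) ltnS card_gt0; apply/set0Pn.
  by exists y; apply: component_refl.
by exists B, w; apply: leaf_branch lB vB.
Qed.

End MaximumMatching.

(** * Blocks *)

Section Blocks.
Variable G : sgraph.
Implicit Types (x y z v w a b c r u : G).
Implicit Types (A B C D H K Q X Y Z S T : {set G}).

Definition block_in A B : bool := maxset (fun S => (S \subset A) && biconnected_in S) B.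

Definition odd_clique B : bool :=
  odd #|B| && [forall x in B, forall y in B, (x != y) ==> adj x y].

Lemma odd_cliqueP B : reflect (clique B /\ odd #|B|) (odd_clique B).
Proof.
apply: (iffP andP) => [[oB /forall_inP clB]|[clB oB]]; split=> //.
  by move=> x y xB yB; have /forall_inP/(_ y yB)/implyP := clB x xB.
by apply/forall_inP=> x xB; apply/forall_inP=> y yB; apply/implyP/clB.
Qed.

Lemma block_inP A B :
  reflect [/\ B \subset A, biconnected_in B &
             forall S, S \subset A -> biconnected_in S -> B \subset S -> S = B] (block_in A B).
Proof.
apply: (iffP maxsetP) => [[/andP[BA bB] maxB]|[BA bB maxB]].
  by split=> // S SA bS; apply: maxB; rewrite SA.
by split=> [|S /andP[SA bS]]; [rewrite BA | apply: maxB].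
Qed.

Lemma conn_neq0 A : connected_in A -> A != set0.
Proof. by case/andP. Qed.

Lemma conn_clique X : clique X -> X != set0 -> connected_in X.
Proof.
move=> clX X0; apply/connected_inP; split=> // x y xX yX.
have [->|xy] := eqVneq x y; first exact: connect0.
by apply: connect1; rewrite /radj /= xX yX clX.
Qed.

Lemma biconn_clique X : clique X -> X != set0 -> biconnected_in X.
Proof.
move=> clX X0; rewrite /biconnected_in conn_clique //=; apply/forall_inP=> v vX.
case: eqVneq => //= Xv; apply: conn_clique Xv.
exact: clique_sub (subsetDl _ _) clX.
Qed.

Definition block_condition A : Prop :=
  (forall B, block_in A B -> odd_clique B) \/
  (exists B, [/\ block_in A B, ~~ odd_clique B,
                 (forall B', block_in A B' -> B' != B -> odd_clique B'),
                 ~~ odd #|B| & extremal B]).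

(** Biconnected sets lie on one side of the gluing at [w]. A block of the trunk
remains maximal: it could only grow inside the leaf, so it would be the single
vertex [w], but [w] has an edge in the trunk. *)
Lemma block_in_leaf A B w S (A1 := A :\: (B :\ w)) :
    connected_in A -> leaf A B w -> 1 < #|A1| ->
  block_in A S = (S == B) || block_in A1 S.
Proof.
move=> cA [wB pB clB oB B1] gtA1.
have B0 : B :\ w != set0 by move: B1; rewrite (cardsD1 w) wB ltnS card_gt0.
have BE : w |: (B :\ w) = B by rewrite setD1K.
have BA : B \subset A by rewrite -BE; apply: pendant_branch_sub.
have bB : biconnected_in B.
  by apply: biconn_clique => //; apply/set0Pn; exists w.
have side T : T \subset A -> biconnected_in T -> (T \subset A1) || (T \subset B).
  by move=> TA bT; have := biconn_side pB TA bT; rewrite BE.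
have A1A : A1 \subset A by apply: subsetDl.
have BnA1 T : B \subset T -> (T \subset A1) = false.
  case/set0Pn: B0 => z zBw BT; apply/negP => /subsetP TA1.
  have /setD1P[_ zB] := zBw.
  by have := TA1 z (subsetP BT z zB); rewrite in_setD zBw.
apply/block_inP/idP=> [[SA bS maxS]|/predU1P[->|/block_inP[SA1 bS maxS]]].
- have /orP[SA1|SB] := side S SA bS; apply/orP; [right | left].
    apply/block_inP; split=> // T TA1; apply: maxS; exact: subset_trans A1A.
  by rewrite (maxS B).
- split=> // T TA bT BT; have := side T TA bT; rewrite BnA1 //= => TB.
  by apply/eqP; rewrite eqEsubset TB.
split=> // [|T TA bT ST]; first exact: subset_trans A1A.
have /orP[TA1|TB] := side T TA bT; first exact: maxS.
have Sw : S = [set w].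
  apply/eqP; rewrite eqEsubset; apply/andP; split.
    apply/subsetP=> z zS; have zB := subsetP TB z (subsetP ST z zS).
    have := subsetP SA1 z zS; rewrite in_setD in_setD1 zB in_set1 andbT.
    by case: (z == w).
  have /andP[/conn_neq0/set0Pn[z zS] _] := bS; rewrite sub1set.
  suff <- : z = w by [].
  have zB := subsetP TB z (subsetP ST z zS).
  have := subsetP SA1 z zS; rewrite in_setD in_setD1 zB andbT.
  by case: eqP.
have cA1 : connected_in A1 by apply: conn_trunk pB cA.
have wA1 : w \in A1 by rewrite in_setD setD11 (pendant_root pB).
have [/exists_inP[u uA1 wu]|nou] := boolP [exists u in A1, adj w u].
  have clwu : clique [set w; u].
    move=> x y /set2P[]-> /set2P[]->; rewrite ?eqxx // adj_sym //.
  have wu0 : [set w; u] != set0 by apply/set0Pn; exists w; rewrite set21.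
  have swu : [set w; u] \subset A1 by apply/subsetP=> z /set2P[]->.
  have Swu : S \subset [set w; u] by rewrite Sw sub1set set21.
  have /setP/(_ u) := maxS _ swu (biconn_clique clwu wu0) Swu.
  by rewrite set22 Sw in_set1 eq_sym (negPf (adj_neq wu)).
have : A1 \subset [set w].
  apply: (conn_closed cA1 wA1 (set11 w)) => x y xA1 yA1 xy /set1P xw.
  by case/exists_inP: nou; exists y => //; rewrite -xw.
by move/subset_leq_card; rewrite cards1 leqNgt gtA1.
Qed.

Lemma block_condition_leaf A B w (A1 := A :\: (B :\ w)) :
  connected_in A -> leaf A B w -> 1 < #|A1| -> block_condition A <-> block_condition A1.
Proof.
move=> cA lB gtA1; have blkE S := block_in_leaf S cA lB gtA1.
have ocB : odd_clique B.
  by apply/odd_cliqueP; split; [apply: leaf_clique lB | apply: leaf_odd lB].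
split=> -[all_odd|[B0 [bB0 nB0 others evB0 eB0]]].
- by left=> S bS; apply: all_odd; rewrite blkE bS orbT.
- right; exists B0; split=> // [|S bS]; last by apply: others; rewrite blkE bS orbT.
  by move: bB0; rewrite blkE; case: eqP nB0 => // ->; rewrite ocB.
- by left=> S; rewrite blkE => /predU1P[->//|]; apply: all_odd.
right; exists B0; split=> // [|S]; first by rewrite blkE bB0 orbT.
by rewrite blkE => /predU1P[->//|]; apply: others.
Qed.

(** Take a branch [C] that is minimal. If [w |: C] had a cut-vertex [u], a
component of [w |: C] minus [u] without [w] would be a smaller branch. So
[w |: C] is a block, and it differs from the exceptional block [B0]. *)
Lemma pendant_leaf A B0 w C : connected_in A ->
    (forall S, block_in A S -> S != B0 -> odd_clique S) ->
    pendant A w C -> connected_in C -> [disjoint C & B0] ->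
  exists B u, leaf A B u.
Proof.
move=> cA others; have [n] := ubnP #|C|; elim: n w C => // n IH w C ltn pC cC dC.
have wC := pendant_notin pC.
have sA := pendant_branch_sub pC.
have cD : connected_in (w |: C) by apply: conn_branch pC cA.
have [bD|nbD] := boolP (biconnected_in (w |: C)).
  have [c cinC] := set0Pn _ (conn_neq0 cC).
  have /others : block_in A (w |: C).
    apply/block_inP; split=> // T TA bT DT.
    have /orP[/subsetP TC|TD] := biconn_side pC TA bT.
      have cD' : c \in w |: C by rewrite in_setU1 cinC orbT.
      by have := TC c (subsetP DT c cD'); rewrite in_setD cinC.
    by apply/eqP; rewrite eqEsubset TD.
  case/(_ _)/odd_cliqueP=> [|clD oD].
    apply/negP => /eqP E; have := disjointFr dC cinC.
    by rewrite -E in_setU1 cinC orbT.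
  exists (w |: C), w; split=> //; rewrite ?setU11 ?setU1K //.
  by rewrite cardsU1 wC ltnS card_gt0 conn_neq0.
move: nbD; rewrite negb_and cD /= => /forall_inPn[u uD]; rewrite negb_or => /andP[D0 nc].
have uC : u \in C.
  move: uD; rewrite in_setU1 => /predU1P[uw|//].
  by rewrite uw setU1K // cC in nc.
have uw : u != w by apply: contraNneq wC => <-.
have wDu : w \in (w |: C) :\ u by rewrite in_setD1 eq_sym uw setU11.
have [y yD yw] : exists2 y, y \in (w |: C) :\ u & ~~ connect (radj ((w |: C) :\ u)) w y.
  apply/exists_inP; apply: contraNT nc; rewrite negb_exists_in => /forall_inP all_w.
  apply/connected_inP; split=> // y z /all_w/negPn yw /all_w/negPn zw.
  by apply: connect_trans zw; rewrite connect_radj_sym.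
set C' := component ((w |: C) :\ u) y.
have pC' : pendant (w |: C) u C' by apply: pendant_component.
have wC' : w \notin C' by rewrite inE connect_radj_sym.
have sC' : C' \subset C.
  apply/subsetP=> z zC'; have /setD1P[_] := subsetP (pendant_sub pC') z zC'.
  by rewrite in_setU1 => /predU1P[zw|//]; rewrite -zw zC' in wC'.
apply: (IH u C').
- rewrite -ltnS; apply: leq_trans ltn; rewrite ltnS; apply: proper_card.
  rewrite properE sC'; apply/subsetPn; exists u => //.
  exact: pendant_notin pC'.
- exact: pendant_trans pC pC' wC'.
- exact: conn_component.
exact: disjointWl sC' dC.
Qed.

(** At a cut-vertex there are two components, and the exceptional block, being
biconnected, meets at most one of them. *)
Lemma block_condition_has_leaf A :
    connected_in A -> block_condition A -> ~~ biconnected_in A ->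
  exists B w, leaf A B w.
Proof.
move=> cA condA nbA.
have [B0 [sB0 others]] : exists B0, (B0 = set0 \/ B0 \subset A /\ biconnected_in B0) /\
    forall S, block_in A S -> S != B0 -> odd_clique S.
  case: condA => [all_odd|[B0 [/block_inP[BA bB _] _ others _ _]]].
    by exists set0; split; [left | move=> S bS _; apply: all_odd].
  by exists B0; split; [right |].
move: nbA; rewrite negb_and cA /= => /forall_inPn[v vA]; rewrite negb_or => /andP[A0 nc].
have [y [z [yA zA yz]]] : exists y z,
    [/\ y \in A :\ v, z \in A :\ v & ~~ connect (radj (A :\ v)) y z].
  move: nc; rewrite negb_and A0 /= => /forall_inPn[y yA /forall_inPn[z zA yz]].
  by exists y, z.
pose C x := component (A :\ v) x.
have pC x : x \in A :\ v -> pendant A v (C x) by apply: pendant_component.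
have dyz : [disjoint C y & C z].
  apply/pred0P=> t; rewrite /= !inE; apply: contraNF yz => /andP[yt zt].
  by apply: connect_trans yt _; rewrite connect_radj_sym.
have [x [xA dx]] : exists x, x \in A :\ v /\ [disjoint C x & B0].
  case: sB0 => [->|[BA bB]].
    by exists y; split=> //; rewrite disjoint_sym; apply/pred0P=> t; rewrite /= inE.
  have /orP[sB|sB] := biconn_side (pC y yA) BA bB.
    exists y; split=> //; rewrite disjoint_sym disjoints_subset.
    by apply/subsetP=> t /(subsetP sB)/setDP[_]; rewrite in_setC.
  exists z; split=> //; rewrite disjoint_sym disjoints_subset.
  apply/subsetP=> t /(subsetP sB); rewrite in_setC in_setU1 => /predU1P[->|ty].
    by apply: (pendant_notin (pC z zA)).
  by rewrite (disjointFr dyz).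
exact: (pendant_leaf cA others (pC x xA) (conn_component xA)).
Qed.

Lemma geo_partition_gt0 A X k : geo_partition A X k -> X != set0 -> 0 < k.
Proof. by case=> //; rewrite eqxx. Qed.

(** An odd clique is a leaf of itself, and peeling it leaves one vertex. *)
Lemma extremal_odd_clique A : clique A -> odd #|A| -> extremal A.
Proof.
move=> clA oA; have /set0Pn[w wA] : A != set0 by apply: contraTneq oA => ->; rewrite cards0.
have single x : extremal [set x].
  exists set0; split; [exact: sub0set | exact: matchable0 |] => k.
  rewrite cards1 cards0 addn0 => /geo_partition_gt0; apply.
  by apply/set0Pn; exists x; rewrite set11.
have [A1|Agt1] := leqP #|A| 1.
  suff -> : A = [set w] by [].
  by apply/esym/eqP; rewrite eqEcard sub1set wA cards1.
have lA : leaf A A w.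
  split=> //; split=> // y z _ zA _.
  by rewrite setD1K.
apply/(extremal_peel lA); suff -> : A :\: (A :\ w) = [set w] by [].
by rewrite setDDr setDv set0U; apply/setIidPr; rewrite sub1set.
Qed.

(** By induction on [A], as each side of the equivalence provides a leaf and
peeling it changes neither side. In the biconnected case there is no leaf other
than [A] itself, and an odd extremal [A] has one by [rooted_leaf]. *)
Theorem extremal_blocks A : connected_in A -> extremal A <-> block_condition A.
Proof.
have [n] := ubnP #|A|; elim: n A => // n IH A ltn cA.
have [bA|nbA] := boolP (biconnected_in A).
  have blkA : block_in A A.
    by apply/block_inP; split=> // S SA _ AS; apply/eqP; rewrite eqEsubset SA.
  have blk_eq S : block_in A S -> S = A by case/block_inP=> SA _ /(_ A (subxx A) bA SA)->.
  split=> [eA|[/(_ A blkA)/odd_cliqueP[]|[B [/blk_eq-> //]]]]; last exact: extremal_odd_clique.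
  have [oA|nA] := boolP (odd_clique A); first by left=> S /blk_eq->.
  right; exists A; split=> //; first by move=> S /blk_eq->; rewrite eqxx.
  apply: contraNN nA => oddA; have [X [XA pmX leX]] := eA.
  have [/matchable_even|[v vA pmv]] := tight_near_perfect XA pmX leX cA; first by rewrite oddA.
  apply/odd_cliqueP; split=> //.
  have [A1|A1] := leqP #|A| 1.
    by move=> x y xA yA; move/card_le1_eqP: A1 => /(_ y x yA xA)->; rewrite eqxx.
  have [B [w [lB _]]] := rooted_leaf cA vA pmv (tight_rooted XA pmX leX vA pmv) A1.
  suff -> : A = B by apply: leaf_clique lB.
  have pB := leaf_pendant lB; have wB := leaf_root lB.
  have /orP[/subsetP AA1|] := biconn_side pB (subxx A) bA.
    have : B :\ w != set0 by have := leaf_gt1 lB; rewrite (cardsD1 w) wB ltnS card_gt0.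
    case/set0Pn=> z zB; have /setD1P[_ zA] := subsetP (pendant_sub pB) z zB.
    by have := AA1 z zA; rewrite in_setD zB.
  rewrite setD1K // => AB; apply/eqP; rewrite eqEsubset AB.
  by rewrite -(setD1K wB) (pendant_branch_sub pB).
have has_leaf : extremal A \/ block_condition A -> exists B w, leaf A B w.
  by case=> h; [apply: extremal_leaf | apply: block_condition_has_leaf].
suff step : (exists B w, leaf A B w) -> extremal A <-> block_condition A.
  by split=> h; apply/step => //; apply: has_leaf; [left | right].
case=> B [w lB]; set A1 := A :\: (B :\ w).
have pB := leaf_pendant lB; have wB := leaf_root lB.
have ltA1 : #|A1| < n.
  rewrite -ltnS; apply: leq_trans ltn; rewrite ltnS; apply: proper_card.
  rewrite properE subsetDl /=; apply/subsetPn.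
  have : B :\ w != set0 by have := leaf_gt1 lB; rewrite (cardsD1 w) wB ltnS card_gt0.
  case/set0Pn=> z zB; have /setD1P[_ zA] := subsetP (pendant_sub pB) z zB.
  by exists z; rewrite // in_setD zB.
have wA1 : w \in A1 by rewrite in_setD setD11 (pendant_root pB).
have gtA1 : 1 < #|A1|.
  rewrite ltnNge; apply/negP => A1le; case/negP: nbA.
  suff -> : A = B.
    by apply: biconn_clique (leaf_clique lB) _; apply/set0Pn; exists w.
  apply/eqP; rewrite eqEsubset -{2}(setD1K wB) (pendant_branch_sub pB) andbT.
  apply/subsetP=> z zA; case: (boolP (z \in B :\ w)) => [/setD1P[]//|zB].
  have zA1 : z \in A1 by rewrite in_setD zB.
  by move/card_le1_eqP: A1le => /(_ w z wA1 zA1)->.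
rewrite (extremal_peel lB) (block_condition_leaf cA lB gtA1).
by apply: IH => //; apply: conn_trunk pB cA.
Qed.

End Blocks.

(** * From vertex sets to the graph itself *)

Section Whole.
Variable G : sgraph.
Implicit Types (x y z v w a b : G) (s t : seq G) (p q : gpath G).
Implicit Types (X Y S : {set G}) (P : {set gpath G}) (M : {set {set G}}).

Lemma walk_setT x s : walk [set: G] x s = path (@adj G) x s.
Proof. by rewrite /walk (_ : all _ _) ?andbT //; apply/allP=> z _; apply: in_setT. Qed.

Lemma gpath_of x s : path (@adj G) x s -> uniq (x :: s) ->
  exists p, verts p = x :: s.
Proof.
move=> xs uxs; have sz : size (x :: s) <= #|G|.
  by rewrite -(card_uniqP uxs) max_card.
have pP : is_path (Bseq sz) by rewrite /is_path /= xs.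
by exists (exist (fun p : #|G|.-bseq G => is_path p) (Bseq sz) pP).
Qed.

Lemma gpath_cons p : exists x s, verts p = x :: s /\ path (@adj G) x s.
Proof.
case: p => p pP; rewrite /verts /=; move: pP; rewrite /is_path.
by case: (bseqval p) => // x s /andP[xs _]; exists x, s.
Qed.

Lemma same_ends_cons p q x s y t : verts p = x :: s -> verts q = y :: t ->
  same_ends p q = (x == y) && (last x s == last y t).
Proof.
by rewrite /same_ends => -> ->; rewrite (lastI x) (lastI y) !rev_rcons -!lastI.
Qed.

(** Shortest among paths and shortest among walks agree, because a walk can be
shortened to a path. *)
Lemma isometricP p : isometric p <-> geodesic [set: G] (verts p).
Proof.
have [x [s [vp xs]]] := gpath_cons p; rewrite vp.
split=> [/forallP min_p|[_ min_s]].
  split=> [|t]; rewrite walk_setT // => xt.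
  case/shortenP: xt => t' xt' ut' st' lt.
  have [q vq] := gpath_of xt' ut'.
  have /implyP := min_p q.
  rewrite (same_ends_cons vp vq) eqxx lt eqxx /plength vp vq /= => /(_ isT) le.
  apply: leq_trans le _; apply: uniq_leq_size; first by case/andP: ut'.
  by move=> z; apply: st'.
apply/forallP=> q; have [y [t [vq yt]]] := gpath_cons q.
rewrite (same_ends_cons vp vq) /plength vp vq /=.
apply/implyP=> /andP[/eqP exy /eqP lst]; subst y.
by apply: min_s; rewrite ?walk_setT.
Qed.

Lemma geo_partition_IPP X k : geo_partition [set: G] X k -> exists P,
  [/\ forall p, p \in P -> isometric p,
      forall v, #|[set p in P | v \in verts p]| = (v \in X) & #|P| = k].
Proof.
elim=> [|s {}X {}k gs sX _ [P [isoP cntP <-]]].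
  exists set0; split=> [p|v|]; rewrite ?inE ?cards0 //.
  by apply/eqP; rewrite cards_eq0; apply/eqP/setP=> p; rewrite !inE.
have [p vp] : exists p, verts p = s.
  have := geo_uniq gs; case: s gs {sX cntP} => // x s [xs _].
  by apply: gpath_of; rewrite -walk_setT.
have pP : p \notin P.
  apply/negP => pP; have [x [t [vpx _]]] := gpath_cons p.
  have := cntP x; rewrite in_setD inE -vp vpx mem_head /=.
  by move/eqP; rewrite cards_eq0 => /eqP/setP/(_ p); rewrite !inE pP vpx mem_head.
exists (p |: P); split.
- move=> q /setU1P[->|/isoP//]; by apply/isometricP; rewrite vp.
- move=> v; rewrite (cardsD1 p) !inE eqxx /= vp.
  have -> : [set q in p |: P | v \in verts q] :\ p = [set q in P | v \in verts q].
    apply/setP=> q; rewrite !inE; case: eqP => //= ->.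
    by rewrite (negPf pP).
  rewrite cntP in_setD inE; case vs: (v \in s) => //=.
  by rewrite (sX _ vs).
by rewrite cardsU1 pP.
Qed.

Lemma IPP_geo_partition X P : (forall p, p \in P -> isometric p) ->
    (forall v, #|[set p in P | v \in verts p]| = (v \in X)) ->
  geo_partition [set: G] X #|P|.
Proof.
have [n] := ubnP #|P|; elim: n P X => // n IH P X ltn isoP cntP.
have [P0|[p pP]] := set_0Vmem P.
  rewrite P0 cards0 (_ : X = set0); first exact: geo_partition0.
  apply/setP=> v; rewrite inE; have := cntP v; rewrite P0.
  rewrite (_ : [set _ in _ | _] = set0) ?cards0; first by case: (v \in X).
  by apply/setP=> q; rewrite !inE.
rewrite (cardsD1 p) pP add1n; apply: (geo_partitionS (p := verts p)).
- exact/isometricP/isoP.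
- move=> v vp; have := cntP v; rewrite (cardsD1 p) !inE pP vp /=.
  by case: (v \in X).
apply: IH => [|q /setD1P[_]|v]; last 2 first.
- exact: isoP.
- have := cntP v; rewrite (cardsD1 p) inE pP in_setD inE /=.
  have -> : [set q in P | v \in verts q] :\ p = [set q in P :\ p | v \in verts q].
    by apply/setP=> q; rewrite !inE andbA.
  by case: (v \in verts p) => //=; case: (v \in X) => // -[].
by move: ltn; rewrite (cardsD1 p) pP.
Qed.

Lemma geo_partition_ippP k :
  geo_partition [set: G] [set: G] k <->
  [exists P : {set gpath G}, is_IPP P && (#|P| == k)].
Proof.
split=> [/geo_partition_IPP[P [isoP cntP cP]]|/existsP[P /andP[/andP[isoP cntP] /eqP<-]]].
  apply/existsP; exists P; rewrite cP eqxx andbT; apply/andP; split.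
    exact/forall_inP.
  by apply/forallP=> v; rewrite cntP inE.
apply: IPP_geo_partition => [p|v]; first by move/forall_inP: isoP; apply.
by rewrite inE; apply/eqP; move/forallP: cntP.
Qed.

Lemma ipp_geo_partition : geo_partition [set: G] [set: G] (ipp G).
Proof. by apply/geo_partition_ippP; rewrite /ipp; case: ex_minnP. Qed.

Lemma ipp_le k : geo_partition [set: G] [set: G] k -> ipp G <= k.
Proof. by move/geo_partition_ippP; rewrite /ipp; case: ex_minnP => m _; apply. Qed.

Lemma matching_matchable M : matching M -> matchable (cover M) /\ #|cover M| = #|M|.*2.
Proof.
have [n] := ubnP #|M|; elim: n M => // n IH M ltn mM.
have [->|[e eM]] := set_0Vmem M.
  by rewrite /cover big_set0 !cards0; split=> //; apply: matchable0.
have /andP[/subsetP ME tM] := mM.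
have mMe : matching (M :\ e).
  apply/andP; split; last exact: trivIsetD.
  by apply/subsetP=> z /setD1P[_ /ME].
have [|pmMe cMe] := IH (M :\ e) _ mMe.
  by move: ltn; rewrite (cardsD1 e M) eM.
rewrite (coverD1 tM eM) in pmMe cMe.
have /imsetP[[a b] /= ab eab] := ME e eM; rewrite inE /= in ab.
have ec : e \subset cover M by apply: (bigcup_max e).
have aM : a \in cover M by apply: (subsetP ec); rewrite eab set21.
have bM : b \in cover M by apply: (subsetP ec); rewrite eab set22.
rewrite eab in pmMe cMe; split; first exact: matchableS pmMe.
by rewrite (card_setD2 aM bM (adj_neq ab)) cMe -eab [#|M|](cardsD1 e) eM doubleD.
Qed.

Lemma matchable_matching X : matchable X -> exists2 M, matching M & cover M = X.
Proof.
elim=> [|a b {}X aX bX ab _ [M /andP[ME tM] cM]].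
  exists set0; last by rewrite /cover big_set0.
  by rewrite /matching sub0set; apply/trivIsetP=> A B; rewrite inE.
have sabX : [set a; b] \subset X by apply/subsetP=> z /set2P[]->.
exists ([set a; b] |: M); last first.
  have cU : cover ([set a; b] |: M) = [set a; b] :|: cover M.
    by rewrite /cover bigcup_setU big_set1.
  rewrite cU cM; apply/setP=> z; rewrite in_setU in_setD.
  by case: (boolP (z \in [set a; b])) => //= /(subsetP sabX)->.
apply/andP; split.
  rewrite subUset ME andbT sub1set; apply/imsetP.
  by exists (a, b); rewrite ?inE.
apply: trivIsetU => //; first exact: trivIset1.
rewrite cover1 cM disjoint_sym.
by apply/pred0P=> z; rewrite /= in_setD; case: (z \in [set a; b]); rewrite ?andbF.
Qed.

Lemma IPP_extremalP : IPP_extremal G <-> extremal [set: G].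
Proof.
have matching0 : matching (set0 : {set {set G}}).
  by rewrite /matching sub0set; apply/trivIsetP=> A B; rewrite inE.
have [M mM eM] : exists2 M : {set {set G}}, matching M & matching_number G = #|M|.
  rewrite /matching_number (bigmax_eq_arg _ matching0).
  by case: arg_maxnP => // M mM _; exists M.
have [pmM cM] := matching_matchable mM.
have leM : #|cover M| <= #|G| by apply: max_card.
rewrite /IPP_extremal eM; split=> [/eqP ippE|[X [_ pmX leX]]].
  exists (cover M); split=> // k /ipp_le; rewrite ippE cardsT cM doubleK.
  by rewrite leq_subLR addnC.
have [N mN cN] := matchable_matching pmX.
have NM : #|N| <= #|M| by rewrite -eM; apply: leq_bigmax_cond.
have := leX _ ipp_geo_partition.
have := ipp_le (geo_partition_matchable pmM (subsetT _) (subxx _)).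
have := cardsID (cover M) [set: G]; rewrite setTI cardsT.
have [_ cX] := matching_matchable mN; rewrite -cN cX cM !doubleK.
rewrite cM in leM.
move: leM NM; move: #|N| #|M| #|[set: G] :\: _| #|G| (ipp G).
by clear => *; apply/eqP; lia.
Qed.

Lemma connected_setT : connected G = connected_in [set: G].
Proof.
have cE : connect (@adj G) =2 connect (radj [set: G]).
  by apply: eq_connect => x y; rewrite /radj /= !inE.
apply/andP/andP=> -[G0 cG]; split.
- by rewrite -card_gt0 cardsT.
- apply/forall_inP=> x _; apply/forall_inP=> y _; rewrite -cE.
  by move/forallP/(_ x)/forallP: cG.
- by rewrite -cardsT card_gt0.
apply/forallP=> x; apply/forallP=> y; rewrite cE.
by move/forall_inP/(_ x (in_setT x))/forall_inP: cG => /(_ y (in_setT y)).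
Qed.

Lemma components_le1 :
  (components G <= 1) = [forall x : G, forall y : G, connect (@adj G) x y].
Proof.
have sym : connect_sym (@adj G) by apply/sym_connect_sym/adj_sym.
apply/idP/forallP => [/card_le1_eqP le1 x|cG].
  apply/forallP=> y; rewrite -(root_connect sym); apply/eqP; apply: le1.
    by rewrite !inE roots_root.
  by rewrite !inE roots_root.
apply/card_le1_eqP=> x y; rewrite !inE !andbT => /eqP<- /eqP<-.
by apply/esym/(rootP sym); move/forallP: (cG x).
Qed.

Lemma connected_components : connected G -> components G = 1.
Proof.
case/andP=> /card_gt0P[x _] cG; apply/eqP; rewrite eqn_leq components_le1 cG.
apply/card_gt0P; exists (root (@adj G) x); rewrite !inE roots_root //.
exact/sym_connect_sym/adj_sym.
Qed.

End Whole.

(** * From vertex sets to induced subgraphs *)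

Section Induced.
Variables (G : sgraph) (S : {set G}).
Let H : sgraph := induced S.
Implicit Types (x y : H) (T X : {set H}) (s : seq H).

Let up (x : H) : G := val x.
Let up_inj : injective up := val_inj.

Lemma induced_lift (v : G) : v \in S -> exists x : H, up x = v.
Proof. by move=> vS; exists (exist _ v vS). Qed.

Lemma induced_lift_seq (t : seq G) : {subset t <= S} -> exists s, t = map up s.
Proof.
elim: t => [|z t IH] tS; first by exists [::].
have [z' <-] := induced_lift (tS z (mem_head _ _)).
have [u zt|t' ->] := IH; first by apply: tS; rewrite inE zt orbT.
by exists (z' :: t').
Qed.

Lemma induced_setT : up @: [set: H] = S.
Proof.
apply/setP=> v; apply/imsetP/idP=> [[x _ ->]|/induced_lift[x <-]]; first exact: valP.
by exists x.
Qed.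

Lemma conn_induced T : connected_in (up @: T) = connected_in T.
Proof.
have cE x y : x \in T -> y \in T ->
    connect (radj (up @: T)) (up x) (up y) = connect (radj T) x y.
  move=> xT yT; apply/idP/idP=> xy.
    pose P v := exists2 y' : H, v = up y' & y' \in T /\ connect (radj T) x y'.
    suff [y' /up_inj<- [_ //]] : P (up y).
    apply: (connect_radj_ind xy); last by exists x; rewrite ?connect0.
    move=> _ _ /imsetP[a aT ->] /imsetP[b bT ->] ab [y' /up_inj<- [_ xa]].
    exists b => //; split=> //; apply: connect_trans xa (connect1 _).
    by rewrite /radj /= aT bT.
  apply: (connect_radj_ind (P := fun y => connect (radj (up @: T)) (up x) (up y)) xy);
    last exact: connect0.
  move=> a b aT bT ab xa; apply: connect_trans xa (connect1 _).
  by rewrite /radj /= !imset_f.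
apply/connected_inP/connected_inP=> -[T0 cT]; split.
- by apply: contraNneq T0 => ->; rewrite imset0.
- by move=> x y xT yT; rewrite -cE //; apply: cT; apply: imset_f.
- by rewrite -card_gt0 card_imset ?card_gt0 //; apply: up_inj.
by move=> _ _ /imsetP[x xT ->] /imsetP[y yT ->]; rewrite cE //; apply: cT.
Qed.

Lemma connected_induced : connected H = connected_in S.
Proof. by rewrite connected_setT -conn_induced induced_setT. Qed.

Lemma geo_induced s : geodesic S (map up s) <-> geodesic [set: H] s.
Proof.
have wE x t : walk S (up x) (map up t) = walk [set: H] x t.
  rewrite walk_setT /walk path_map.
  rewrite [all _ _](_ : _ = true) ?andbT.
    exact: eq_path.
  by apply/allP=> _ /(mapP (s := x :: t))[z _ ->]; apply: valP.
case: s => // x s; split=> -[Ws min_s]; split; rewrite ?wE // in Ws *.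
  move=> t Wt lt; rewrite -(size_map up s) -(size_map up t); apply: min_s.
    by rewrite wE.
  by rewrite !last_map lt.
move=> t Wt; have [t' et] : exists t', t = map up t'.
  by apply: induced_lift_seq => z zt; apply: (walk_mem Wt); rewrite inE zt orbT.
by move: Wt; rewrite et wE !last_map !size_map => Wt /up_inj; apply: min_s.
Qed.

Lemma imset_up_D X T : up @: (X :\: T) = up @: X :\: up @: T.
Proof.
apply/setP=> v; rewrite in_setD; apply/imsetP/andP=> [[x /setDP[xX xT] ->]|].
  by split; [apply: contraNN xT => /imsetP[y yT /up_inj->] | apply: imset_f].
case=> vT /imsetP[x xX ev]; exists x; rewrite // in_setD xX andbT.
by apply: contraNN vT => xT; rewrite ev imset_f.
Qed.

Lemma imset_up_seq s : [set v in map up s] = up @: [set x in s].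
Proof.
apply/setP=> v; rewrite inE; apply/mapP/imsetP=> -[x xs ->]; exists x;
  by rewrite ?inE in xs *.
Qed.

Lemma matchable_induced X : matchable (up @: X) <-> matchable X.
Proof.
split; last first.
  elim=> [|a b {}X aX bX ab _ IH]; first by rewrite imset0; apply: matchable0.
  apply: (matchableS (imset_f up aX) (imset_f up bX) ab).
  by move: IH; rewrite imset_up_D imsetU1 imset_set1.
move eY: (up @: X) => Y pmY.
elim: pmY X eY => [|a b {}Y aY bY ab _ IH] X eY.
  have -> : X = set0 by apply/eqP; rewrite -(imset_eq0 up) eY.
  exact: matchable0.
move: aY bY ab IH; rewrite -eY => /imsetP[a' aX ->] /imsetP[b' bX ->] ab IH.
apply: (matchableS aX bX ab); apply: IH.
by rewrite imset_up_D imsetU1 imset_set1.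
Qed.

Lemma geo_partition_induced X k :
  geo_partition S (up @: X) k <-> geo_partition [set: H] X k.
Proof.
split; last first.
  elim=> [|s {}X {}k gs sX _ IH]; first by rewrite imset0; apply: geo_partition0.
  apply: (geo_partitionS (p := map up s)); first exact/geo_induced.
    by move=> _ /mapP[x /sX xX ->]; apply: imset_f.
  by rewrite imset_up_seq -imset_up_D.
move eY: (up @: X) => Y covY.
elim: covY X eY => [|p {}Y {}k gp pY _ IH] X eY.
  have -> : X = set0 by apply/eqP; rewrite -(imset_eq0 up) eY.
  exact: geo_partition0.
have [s ep] : exists s, p = map up s.
  by apply: induced_lift_seq => z; apply: geo_mem gp.
move: gp pY IH; rewrite ep -eY => gp pY IH.
apply: (geo_partitionS (p := s)); first exact/geo_induced.
  move=> x xs; have /imsetP[y yX /up_inj->] : up x \in up @: X; last by [].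
    by apply: pY; apply: map_f.
by apply: IH; rewrite imset_up_seq imset_up_D.
Qed.

Lemma extremal_induced : extremal [set: H] <-> extremal S.
Proof.
have cH : #|[set: H]| = #|S| by rewrite -(card_imset _ up_inj) induced_setT.
have covE k : geo_partition S S k <-> geo_partition [set: H] [set: H] k.
  by rewrite -geo_partition_induced induced_setT.
split=> -[X [XS pmX leX]].
  exists (up @: X); split; last 1 first.
  - by move=> k /covE; rewrite -cH card_imset //; apply: leX.
  - by apply/subsetP=> _ /imsetP[x _ ->]; apply: valP.
  exact/matchable_induced.
have XE : X = up @: (up @^-1: X).
  apply/setP=> v; apply/idP/imsetP=> [vX|[x]]; last by rewrite inE => xX ->.
  by have [x ev] := induced_lift (subsetP XS v vX); exists x; rewrite // inE ev.
exists (up @^-1: X); split; first exact: subsetT.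
  by apply/matchable_induced; rewrite -XE.
by move=> k /covE/leX; rewrite cH {1}XE card_imset.
Qed.

Lemma biconn_induced : biconnected_in [set: H] = biconnected_in S.
Proof.
have DE x : S :\ up x = up @: ([set: H] :\ x).
  by rewrite imset_up_D induced_setT imset_set1.
rewrite /biconnected_in -(conn_induced [set: H]) induced_setT; congr (_ && _).
apply/forall_inP/forall_inP=> bH v.
  by case/induced_lift=> x <-; rewrite DE conn_induced imset_eq0; apply: bH.
by move=> _; rewrite -conn_induced -(imset_eq0 up) -DE; apply: bH; apply: valP.
Qed.

End Induced.

Lemma biconnected_setT (G : sgraph) : biconnected G = biconnected_in [set: G].
Proof.
rewrite /biconnected /biconnected_in -connected_setT; case cG: (connected G) => //=.
apply: eq_forallb => v; rewrite inE /= /cut_vertex (connected_components cG).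
rewrite negb_and -!leqNgt components_le1 setTD.
have card_v : #|G| = #|[set~ v]|.+1 by rewrite -cardsT (cardsD1 v) inE setTD.
rewrite -cards_eq0 card_v ltnS leqn0; case: eqP => //= /eqP v0.
rewrite -connected_induced /connected card_sig.
by rewrite (eq_card (B := mem [set~ v])) ?card_gt0 -?cards_eq0 ?v0.
Qed.

Lemma biconnected_induced (G : sgraph) (S : {set G}) :
  biconnected (induced S) = biconnected_in S.
Proof. by rewrite biconnected_setT biconn_induced. Qed.

Lemma IPP_extremal_induced (G : sgraph) (S : {set G}) :
  IPP_extremal (induced S) <-> extremal S.
Proof. exact: iff_trans (IPP_extremalP _) (extremal_induced S). Qed.

Lemma card_induced (G : sgraph) (S : {set G}) : #|induced S| = #|S|.
Proof. by rewrite -cardsT -(card_imset _ val_inj) induced_setT. Qed.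

Lemma odd_complete_induced (G : sgraph) (S : {set G}) :
  odd_complete (induced S) = odd_clique S.
Proof.
rewrite /odd_complete /odd_clique card_induced; congr (_ && _).
apply/forallP/forall_inP=> cS.
  move=> x xS; apply/forall_inP=> y yS.
  by have /forallP := cS (exist _ x xS) => /(_ (exist _ y yS)).
move=> x; apply/forallP=> y.
by have /forall_inP := cS _ (valP x) => /(_ _ (valP y)).
Qed.

Lemma block_block_in (G : sgraph) (B : {set G}) : block B = block_in [set: G] B.
Proof.
by apply: maxset_eq => S; rewrite subsetT biconnected_induced.
Qed.

Theorem theorem1p8 (G : sgraph) (connG : connected G) :
  IPP_extremal G <->
  (forall B : {set G}, block B -> odd_complete (induced B))
  \/
  (exists B : {set G},
     [/\ block B,
         ~~ odd_complete (induced B),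
         (forall B' : {set G},
            block B' -> B' != B -> odd_complete (induced B')),
         ~~ odd #|induced B|
       & IPP_extremal (induced B)]).
Proof.
rewrite connected_setT in connG.
apply: iff_trans (IPP_extremalP G) _; apply: iff_trans (extremal_blocks connG) _.
split=> -[all_odd|[B [bB nB others evB eB]]].
- by left=> B; rewrite block_block_in odd_complete_induced; apply: all_odd.
- right; exists B; split; rewrite ?block_block_in ?odd_complete_induced ?card_induced //.
    by move=> B'; rewrite block_block_in odd_complete_induced; apply: others.
  exact/IPP_extremal_induced.
- by left=> B; rewrite -block_block_in -odd_complete_induced; apply: all_odd.
right; exists B.
rewrite -block_block_in -odd_complete_induced -card_induced; split=> //.
  by move=> B'; rewrite -block_block_in -odd_complete_induced; apply: others.
exact/IPP_extremal_induced.
Qed.
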